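(* Let $E,E'$ be real Banach spaces of dimension at least $2$, let $D\subsetneq E$ and $D'\subsetneq E'$ be $c$-uniform domains, and suppose that the boundary of $D$ is $(r_1,r_2)$-HD, where $0<r_1\le r_2<1$. Let $L\ge1$, $M\ge1$ and let $f:\overline{D}\to\overline{D'}$ be a homeomorphism such that $f|_D$ is a $\varphi$-FQC map of $D$ onto $D'$ with $\varphi(t)=Mt$, and $f|_{\partial D}:\partial D\to\partial D'$ is $L$-bilipschitz. Then $f$ is $M'$-bilipschitz in $\overline{D}$, where $M'$ depends only on $c$, $r_1$, $r_2$, $L$ and $M$.
   Context: The norm of $E$ or $E'$ is $|\cdot|$. A domain is a nonempty open connected set. $\dot E=E\cup\{\infty\}$ is the Hausdorff space in which the neighborhoods of $\infty$ are the complements of closed bounded sets of $E$; boundaries $\partial A$ and closures $\overline{A}$ of sets $A\subset E$ are taken in $\dot E$ (similarly for $E'$), so $\infty\in\partial D$ when $D$ is unbounded. For a domain $D\subsetneq E$, $d_D(z)$ is the norm distance from $z\in D$ to $\partial D$, and $k_D(z_1,z_2)=\inf_\alpha\int_\alpha |dz|/d_D(z)$ is the quasihyperbolic distance, the infimum being over all rectifiable arcs $\alpha$ in $D$ joining $z_1$ to $z_2$. $D$ is $c$-uniform if each pair $z_1,z_2\in D$ can be joined by a rectifiable arc $\alpha$ in $D$ with $\min_{j=1,2}\ell(\alpha[z_j,z])\le c\,d_D(z)$ for all $z\in\alpha$ and $\ell(\alpha)\le c|z_1-z_2|$, where $\ell$ is norm length and $\alpha[z_j,z]$ is the part of $\alpha$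 between $z_j$ and $z$. For a homeomorphism $\varphi:[0,\infty)\to[0,\infty)$ with $\varphi(t)\ge t$, a homeomorphism $f:G\to G'$ between domains is $\varphi$-solid if $k_{G'}(f(x),f(y))\le\varphi(k_G(x,y))$ for all $x,y\in G$ and $f^{-1}$ satisfies the analogous inequality. It is $\varphi$-FQC (freely $\varphi$-quasiconformal, fully $\varphi$-solid) if for every subdomain $G_1\subset G$ the map $f|_{G_1}:G_1\to f(G_1)$ is $\varphi$-solid. A metric space $X$ is $(r_1,r_2)$-HD (homogeneously dense), $0<r_1\le r_2<1$, if for each pair $a,b\in X$ there is $x\in X$ with $r_1|b-a|\le|x-a|\le r_2|b-a|$. HD spaces are understood to have no isolated points. For a boundary $\partial D\subset\dot E$, being $(r_1,r_2)$-HD means that the metric space $\partial D\cap E$ satisfies this condition and $\partial D$ has no isolated point in $\dot E$ (so $\partial D\cap E$ has more than one point, and is unbounded if $D$ is unbounded); for example $\partial(E\setminus\{0\})=\{0,\infty\}$ is not HD. $f$ is $L$-bilipschitz on a set if $|x-y|/L\le|f(x)-f(y)|\le L|x-y|$ for all points $x,y$ of it. Convention on boundaries: the $L$-bilipschitz condition on $\partial D$ means that $f$ maps $\partial D\cap E$ onto $\partial D'\cap E'$ and satisfies this inequality for all $x,y\in\partial D\cap E$; in particular, $f(\infty)=\infty$ if $\infty\in\partial D$. Being $M'$-bilipschitz in $\overline{D}$ refers to the finite points $\overline{D}\cap E$. *)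

(* Defs.v *)
From HB Require Import structures.
From mathcomp Require Import all_boot all_order all_algebra.
From mathcomp Require Import all_classical all_reals all_analysis.

Set Implicit Arguments.
Unset Strict Implicit.
Unset Printing Implicit Defensive.

Import Order.TTheory GRing.Theory Num.Theory.
Import numFieldNormedType.Exports.

Local Open Scope classical_set_scope.
Local Open Scope ring_scope.

Definition dim_ge2 (R : realType) (E : normedModType R) : Prop :=
  exists u v : E, forall a b : R, a *: u + b *: v = 0 -> a = 0 /\ b = 0.

(* The space E with a point at infinity whose neighbourhoods are the
   complements of the closed bounded sets.  The library's
   one_point_compactification uses closed compact sets instead, which gives a
   different topology when E is infinite-dimensional. *)
Definition infty_extension (R : realType) (E : normedModType R) : Type := option E.

Definition fin_pt (R : realType) (E : normedModType R) (x : E) : infty_extension E :=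
  Some x.

Definition infty_pt (R : realType) (E : normedModType R) : infty_extension E := None.

Section extended_topology.
Context {R : realType} {E : normedModType R}.

HB.instance Definition _ := Choice.on (infty_extension E).

Definition extended_nbhs (p : infty_extension E) : set_system (infty_extension E) :=
  if p is Some x then fin_pt x' @[x' --> x]
  else filter_from [set C : set E | closed C /\ bounded_set C]
                   (fun C => ~` (@fin_pt R E @` C)).

Let extended_filter (p : infty_extension E) : ProperFilter (extended_nbhs p).
Proof.
case: p => [x|]; first exact: fmap_proper_filter.
apply: filter_from_proper; last by move=> C _; exists (infty_pt E) => -[].
apply: filter_from_filter.
  by exists set0; split; [exact: closed0 | apply: (@nearW _ (pinfty_nbhs R)) => M x].
move=> P Q [cP bP] [cQ bQ]; exists (P `|` Q).
  split; first exact: closedU.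
  apply: (@filterS2 _ (pinfty_nbhs R) _ _ _ _ _ bP bQ) => M PM QM x.
  by case; [exact: PM | exact: QM].
by rewrite image_setU setCU.
Qed.

Let extended_singleton (p : infty_extension E) U : extended_nbhs p U -> U p.
Proof. by case: p => [x /= /nbhs_singleton//|[C _]]; apply => -[]. Qed.

Let extended_nbhs_nbhs (p : infty_extension E) (A : set (infty_extension E)) :
  extended_nbhs p A -> extended_nbhs p (extended_nbhs^~ A).
Proof.
case: p => [x|] /=; first exact: nbhs_interior.
case=> C [cC bC] CA; exists C => // -[y|] nC; last by exists C.
have nCy : ~ C y by move=> Cy; apply: nC; exists y.
change (nbhs y (@fin_pt R E @^-1` A)); rewrite nbhsE.
exists (~` C); first by split; [exact: closed_openC|].
by move=> z nCz; apply: CA => -[w Cw [wz]]; apply: nCz; rewrite -wz.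
Qed.

HB.instance Definition _ := hasNbhs.Build (infty_extension E) extended_nbhs.

HB.instance Definition _ := @Nbhs_isNbhsTopological.Build (infty_extension E)
  extended_filter extended_singleton extended_nbhs_nbhs.

End extended_topology.

Section sets.
Context {R : realType} {E : normedModType R}.
Implicit Types D : set E.

Definition domain D : Prop := [/\ D !=set0, open D & connected D].

Definition ext_closure D : set (infty_extension E) := closure (@fin_pt R E @` D).

Definition ext_boundary D : set (infty_extension E) :=
  closure (@fin_pt R E @` D) `\` interior (@fin_pt R E @` D).

Definition boundary_dist D (z : E) : R :=
  inf [set `|z - w| | w in @fin_pt R E @^-1` ext_boundary D].

(* The first clause is the HD condition of the metric space of finite boundary
   points; isolation is tested in the extended space. *)
Definition boundary_HD (r1 r2 : R) D : Prop :=
  (forall a b : E, ext_boundary D (fin_pt a) -> ext_boundary D (fin_pt b) ->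
     exists x : E, [/\ ext_boundary D (fin_pt x),
       r1 * `|b - a| <= `|x - a| & `|x - a| <= r2 * `|b - a|]) /\
  isolated (ext_boundary D) = set0.

End sets.

Section arcs.
Context {R : realType} {E : normedModType R}.
Implicit Types (D : set E) (alpha : R -> E) (a b : R).

Definition arc_length alpha a b : \bar R :=
  ereal_sup [set (\sum_(0 <= i < size s)
      `|alpha (nth b (a :: s) i.+1) - alpha (nth b (a :: s) i)|)%:E
    | s in [set s : seq R | itv_partition a b s]].

(* The case a = b is allowed: an arc from a point to itself is degenerate. *)
Definition rectifiable_arc alpha a b : Prop :=
  [/\ a <= b, {within `[a, b], continuous alpha},
      {in `[a, b] &, injective alpha} & (arc_length alpha a b < +oo)%E].

Definition arc_joins D alpha a b (z1 z2 : E) : Prop :=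
  [/\ rectifiable_arc alpha a b, alpha @` `[a, b] `<=` D,
      alpha a = z1 & alpha b = z2].

(* The point of the arc at arc length s from its initial point. *)
Definition arclength_param alpha a b (s : R) : E :=
  alpha (inf [set t | t \in `[a, b] /\ (s%:E <= arc_length alpha a t)%E]).

Definition arc_integral (rho : E -> R) alpha a b : \bar R :=
  (\int[lebesgue_measure]_(s in `[0%R, fine (arc_length alpha a b)])
     (rho (arclength_param alpha a b s))%:E)%E.

(* For a proper subdomain D and points of D the infimum is finite. *)
Definition quasihyperbolic D (z1 z2 : E) : R :=
  fine (ereal_inf [set l : \bar R | exists alpha a b,
    arc_joins D alpha a b z1 z2 /\
    l = arc_integral (fun z => (boundary_dist D z)^-1) alpha a b]).

Definition uniform_domain (c : R) D : Prop :=
  forall z1 z2 : E, D z1 -> D z2 -> exists alpha a b,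
    [/\ arc_joins D alpha a b z1 z2,
        forall t, t \in `[a, b] ->
          (Order.min (arc_length alpha a t) (arc_length alpha t b)
             <= (c * boundary_dist D (alpha t))%:E)%E
      & (arc_length alpha a b <= (c * `|z1 - z2|)%:E)%E].

End arcs.

(* f, g are total functions; only their restrictions to A and B matter. *)
Definition inverse_homeos (T U : topologicalType) (A : set T) (B : set U)
    (f : T -> U) (g : U -> T) : Prop :=
  [/\ f @` A `<=` B, g @` B `<=` A,
      (forall x, A x -> g (f x) = x) /\ (forall y, B y -> f (g y) = y),
      {within A, continuous f} & {within B, continuous g}].

Definition homeo_between (T U : topologicalType) (A : set T) (B : set U)
    (f : T -> U) : Prop :=
  exists g, inverse_homeos A B f g.

Section maps.
Context {R : realType} {E E' : normedModType R}.

Definition control_function (phi : R -> R) : Prop :=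
  homeo_between [set t : R | 0 <= t] [set t : R | 0 <= t] phi /\
  forall t, 0 <= t -> t <= phi t.

Definition solid (phi : R -> R) (G : set E) (G' : set E') (f : E -> E') : Prop :=
  exists g : E' -> E,
    [/\ inverse_homeos G G' f g,
        forall x y, G x -> G y ->
          quasihyperbolic G' (f x) (f y) <= phi (quasihyperbolic G x y)
      & forall x' y', G' x' -> G' y' ->
          quasihyperbolic G (g x') (g y') <= phi (quasihyperbolic G' x' y')].

Definition FQC (phi : R -> R) (G : set E) (G' : set E') (f : E -> E') : Prop :=
  [/\ control_function phi, homeo_between G G' f &
      forall G1 : set E, domain G1 -> G1 `<=` G -> solid phi G1 (f @` G1) f].

(* The finite points of A are mapped to finite points, with the bilipschitz
   inequalities. *)
Definition bilipschitz_on (L : R) (A : set (infty_extension E))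
    (f : infty_extension E -> infty_extension E') : Prop :=
  forall x y : E, A (fin_pt x) -> A (fin_pt y) -> exists x' y' : E',
    [/\ f (fin_pt x) = fin_pt x', f (fin_pt y) = fin_pt y',
        `|x - y| / L <= `|x' - y'| & `|x' - y'| <= L * `|x - y|].

Definition boundary_bilipschitz (L : R) (D : set E) (D' : set E')
    (f : infty_extension E -> infty_extension E') : Prop :=
  f @` (ext_boundary D `&` range (@fin_pt R E)) =
    ext_boundary D' `&` range (@fin_pt R E') /\
  bilipschitz_on L (ext_boundary D) f.

End maps.

(* Main.v *)
(* Write j(x, y) = ln (1 + |x - y| / min(d(x), d(y))). In a uniform domain the
   quasihyperbolic distance is comparable to j, so f and its inverse distort j
   at most linearly; nothing else about the interior behaviour of f is used.

   Given x in D, the density of the boundary yields boundary points b1, b2 whose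
   distances to x and to each other are comparable to d(x). A sequence of points
   descending to b1 inside a cone is a j-geodesic up to constants, and so is its
   image, which ends at f(b1). If f(x) were far from f(b1) and f(b2) compared with
   r = L d(x), the images of the sequences at b1 and at b2 would both cross the
   ball of radius r around their endpoint, and each would contain there a point at
   distance about r from the boundary of D'. These two image points are j-close,
   so their preimages are j-close; since b1 and b2 are separated this is possible
   only at scale d(x), hence both are j-close to x. Therefore |f(x) - f(b1)| is at
   most a multiple of d(x). From this f is Lipschitz: near points are controlled
   by j, far points by the boundary values. The boundary of D' inherits the density
   property through f, so the same argument applies to the inverse. *)

Require Import Defs.
From mathcomp Require Import all_boot all_order all_algebra.
From mathcomp Require Import all_classical all_reals all_analysis.
From mathcomp Require Import ring lra zify.
Import Order.TTheory GRing.Theory Num.Theory.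
Import numFieldNormedType.Exports.
Local Open Scope classical_set_scope.
Local Open Scope ring_scope.

Set Implicit Arguments.
Unset Strict Implicit.
Unset Printing Implicit Defensive.

(** * Length of arcs *)

Section arc_length.
Context {R : realType} {E : normedModType R}.
Implicit Types (alpha : R -> E) (a b t : R) (s : seq R).

(** The recursive form of the sum that defines [arc_length], suited to induction on partitions. *)
Fixpoint polygon_length alpha a s : R :=
  if s is x :: s' then `|alpha x - alpha a| + polygon_length alpha x s' else 0.

Lemma polygon_lengthE alpha a b s :
  \sum_(0 <= i < size s)
    `|alpha (nth b (a :: s) i.+1) - alpha (nth b (a :: s) i)| =
  polygon_length alpha a s.
Proof.
elim: s a => [|x s IH] a; first by rewrite big_nil.
by rewrite big_nat_recl//= -IH.
Qed.

Lemma arc_length_ub alpha a b s : itv_partition a b s ->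
  ((polygon_length alpha a s)%:E <= arc_length alpha a b)%E.
Proof.
by move=> ps; apply: ereal_sup_ubound; exists s => //; rewrite polygon_lengthE.
Qed.

Lemma arc_length_le alpha a b (l : \bar R) :
  (forall s, itv_partition a b s -> ((polygon_length alpha a s)%:E <= l)%E) ->
  (arc_length alpha a b <= l)%E.
Proof.
by move=> H; apply: ge_ereal_sup => _ [s ps <-]; rewrite polygon_lengthE; exact: H.
Qed.

Lemma polygon_length_cat alpha a s1 s2 : polygon_length alpha a (s1 ++ s2) =
  polygon_length alpha a s1 + polygon_length alpha (last a s1) s2.
Proof. by elim: s1 a => [|x s1 IH] a /=; rewrite ?add0r// IH addrA. Qed.

Lemma norm_le_arc_length alpha a b : a <= b ->
  (`|alpha b - alpha a|%:E <= arc_length alpha a b)%E.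
Proof.
rewrite le_eqVlt => /predU1P[<-|ab].
  by rewrite subrr normr0; exact: (@arc_length_ub alpha a a [::]).
apply: le_trans (arc_length_ub alpha (itv_partition1 ab)).
by rewrite /= addr0.
Qed.

Lemma arc_length_ge0 alpha a b : a <= b -> (0 <= arc_length alpha a b)%E.
Proof. by move=> /(norm_le_arc_length alpha); apply: le_trans; rewrite lee_fin. Qed.


Lemma itv_partition_exists a b : a <= b -> exists s, itv_partition a b s.
Proof.
rewrite le_eqVlt => /predU1P[->|ab]; first by exists [::].
by exists [:: b]; exact: itv_partition1.
Qed.

(** Concatenated partitions give a polygon of the whole arc. The two suprema are taken one after the
    other, so the first length must be known to be finite before it is moved across the
    inequality. *)
Lemma arc_length_super alpha a t b :
  (arc_length alpha a b < +oo)%E -> a <= t -> t <= b ->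
  (arc_length alpha a t + arc_length alpha t b <= arc_length alpha a b)%E.
Proof.
move=> fin at_ tb.
have H s1 s2 : itv_partition a t s1 -> itv_partition t b s2 ->
    ((polygon_length alpha a s1)%:E + (polygon_length alpha t s2)%:E <=
     arc_length alpha a b)%E.
  move=> p1 p2; have /eqP l1 := p1.2.
  have -> : polygon_length alpha t s2 = polygon_length alpha (last a s1) s2.
    by rewrite l1.
  rewrite -EFinD -polygon_length_cat; apply: arc_length_ub.
  exact: itv_partition_cat p1 p2.
have H1 s2 : itv_partition t b s2 -> (arc_length alpha a t <=
    arc_length alpha a b - (polygon_length alpha t s2)%:E)%E.
  by move=> p2; apply: arc_length_le => s1 p1; rewrite leeBrDr// H.
have [s2 p2] := itv_partition_exists tb.
have fin1 : arc_length alpha a t \is a fin_num.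
  rewrite ge0_fin_numE ?arc_length_ge0//; apply: le_lt_trans (H1 _ p2) _.
  by rewrite lteBlDr// adde_ltoo.
rewrite addeC -leeBrDr//; apply: arc_length_le => s p.
by rewrite leeBrDr// addeC -leeBrDr// H1.
Qed.

(** By the triangle inequality, inserting [t] as a new vertex does not shorten the polygon. *)
Lemma polygon_length_split alpha a b t s : itv_partition a b s -> a <= t -> t <= b ->
  exists s1 s2, [/\ itv_partition a t s1, itv_partition t b s2 &
    polygon_length alpha a s <= polygon_length alpha a s1 + polygon_length alpha t s2].
Proof.
elim: s a => [|x s IH] a [/= + /eqP lb].
  move=> _ at_ tb; have {tb} tE : t = a by apply/le_anti; rewrite at_ -lb in tb *; rewrite tb.
  by subst t; rewrite -lb; exists [::], [::]; split => //=; rewrite addr0.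
move=> /andP[ax xs]; rewrite le_eqVlt => /predU1P[<-|at_] tb.
  by exists [::], (x :: s); split => //=; [rewrite /itv_partition/= ax xs lb|rewrite add0r].
have [tx|xt|->] := ltgtP t x; last first.
- exists [:: x], s; split => /=; [exact: itv_partition1| |by rewrite addr0].
  by split => //; apply/eqP.
- have [|s1 [s2 [p1 p2 H]]] := IH x _ (ltW xt) tb; first by split => //; apply/eqP.
  exists (x :: s1), s2; split => //=; last by rewrite -addrA lerD2l.
  by case: p1 => p1 p1'; split => //=; rewrite ax.
- exists [:: t], (x :: s); split => /=; [exact: itv_partition1| |].
    by split => //=; [rewrite tx | apply/eqP].
  rewrite addr0 addrA lerD2r addrC (le_trans _ (ler_normD _ _))//.
  by rewrite addrA subrK.
Qed.

Lemma arc_length_sub alpha a t b : a <= t -> t <= b ->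
  (arc_length alpha a b <= arc_length alpha a t + arc_length alpha t b)%E.
Proof.
move=> at_ tb; apply: arc_length_le => s ps.
have [s1 [s2 [p1 p2 H]]] := polygon_length_split alpha ps at_ tb.
apply: (@le_trans _ _ ((polygon_length alpha a s1)%:E + (polygon_length alpha t s2)%:E)%E).
  by rewrite -EFinD lee_fin.
by apply: leeD; exact: arc_length_ub.
Qed.

Lemma arc_length_add alpha a t b :
  (arc_length alpha a b < +oo)%E -> a <= t -> t <= b ->
  (arc_length alpha a b = arc_length alpha a t + arc_length alpha t b)%E.
Proof.
move=> fin at_ tb; apply/eqP; rewrite eq_le arc_length_sub//=.
exact: arc_length_super.
Qed.


Lemma within_continuous_dist alpha a b t0 (e : R) :
  {within `[a, b], continuous alpha} -> t0 \in `[a, b] -> 0 < e ->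
  exists2 d, 0 < d & forall t, t \in `[a, b] -> `|t0 - t| < d ->
    `|alpha t0 - alpha t| < e.
Proof.
move=> ca t0ab e0; have /subspace_continuousP/(_ t0) := ca.
move=> /(_ t0ab)/cvgrPdist_lt/(_ e e0); rewrite near_withinE.
move=> /nbhs_ballP[d /= d0 H]; exists d => // t tab td.
exact: H.
Qed.

(** The last vertex [t0] of a polygon can be moved back to a slightly earlier parameter, which by
    continuity costs less than [e]. Hence length does not jump at [t0]. *)
Lemma arc_length_le_left alpha a t0 (l : R) :
  (forall e, 0 < e -> exists2 d, 0 < d & forall t, a <= t < t0 ->
     t0 - t < d -> `|alpha t0 - alpha t| < e) ->
  a < t0 -> (forall t, a <= t < t0 -> (arc_length alpha a t <= l%:E)%E) ->
  (arc_length alpha a t0 <= l%:E)%E.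
Proof.
move=> ca at0 H; apply: arc_length_le => s.
elim/last_ind: s => [/itv_partition_nil at0'|s x _]; first by rewrite at0' ltxx in at0.
case; rewrite last_rcons => + /eqP xt0; rewrite {x}xt0 rcons_path => /andP[ps lt0].
set u := last a s in lt0.
have au : a <= u.
  rewrite /u; elim: (s) (a) ps => //= y s' IH z /andP[zy ys].
  by rewrite (le_trans (ltW zy))// IH.
rewrite -cats1 polygon_length_cat /= addr0 lee_fin -/u.
apply/ler_addgt0Pr => e e0; have [d d0 cd] := ca _ e0.
pose t := Num.max ((u + t0) / 2) (t0 - d / 2).
have ut : u < t by rewrite lt_max; apply/orP; left; lra.
have tt0 : t < t0 by rewrite gt_max; apply/andP; split; lra.
have td : t0 - t < d.
  have : t0 - d / 2 <= t by rewrite le_max lexx orbT.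
  lra.
have tab : a <= t < t0 by rewrite (le_trans au (ltW ut)).
have := arc_length_ub alpha (itv_partition_cat _ (itv_partition1 ut)).
move=> /(_ a s); rewrite polygon_length_cat /= addr0.
move=> /(_ (conj ps (eqxx _)))/le_trans/(_ (H t tab)); rewrite lee_fin -/u => K.
have := cd t tab td; have := ler_distD (alpha t) (alpha t0) (alpha u).
lra.
Qed.

Lemma arc_length_le_right alpha t0 b (l : R) :
  (forall e, 0 < e -> exists2 d, 0 < d & forall t, t0 < t <= b ->
     t - t0 < d -> `|alpha t0 - alpha t| < e) ->
  t0 < b -> (forall t, t0 < t <= b -> (arc_length alpha t b <= l%:E)%E) ->
  (arc_length alpha t0 b <= l%:E)%E.
Proof.
move=> ca t0b H; apply: arc_length_le => -[/itv_partition_nil t0b'|u s].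
  by rewrite t0b' ltxx in t0b.
case=> /= /andP[t0u us] lb; rewrite lee_fin.
have ub : u <= b.
  rewrite -(eqP lb); elim: (s) (u) us => //= y s' IH z /andP[zy ys].
  by rewrite (le_trans (ltW zy))// IH.
apply/ler_addgt0Pr => e e0; have [d d0 cd] := ca _ e0.
pose t := Num.min ((u + t0) / 2) (t0 + d / 2).
have tu : t < u by rewrite gt_min; apply/orP; left; lra.
have t0t : t0 < t by rewrite lt_min; apply/andP; split; lra.
have td : t - t0 < d.
  have : t <= t0 + d / 2 by rewrite ge_min lexx orbT.
  lra.
have tab : t0 < t <= b by rewrite t0t/= (le_trans (ltW tu)).
have := @arc_length_ub alpha t b (u :: s).
rewrite /= => /(_ _)/le_trans/(_ (H t tab)); rewrite lee_fin => K.
have {}K := K (conj (introT andP (conj tu us)) lb).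
have := cd t tab td; have := ler_distD (alpha t) (alpha u) (alpha t0).
rewrite (distrC (alpha t)); lra.
Qed.

(** Let [t0] be the infimum in [arclength_param]. Lengths up to earlier parameters are below [s],
    those up to later ones are at least [s]. By continuity the part before [t0] has length at most
    [s] and the part after it at most the total minus [s]; additivity turns both into equalities. *)
Lemma arclength_paramP alpha a b (s : R) : rectifiable_arc alpha a b ->
  0 <= s -> (s%:E <= arc_length alpha a b)%E ->
  exists t, [/\ t \in `[a, b], arclength_param alpha a b s = alpha t,
    arc_length alpha a t = s%:E &
    arc_length alpha t b = (arc_length alpha a b - s%:E)%E].
Proof.
move=> [ab ca _ fin] s0 sl.
have finl : arc_length alpha a b \is a fin_num by rewrite ge0_fin_numE// arc_length_ge0.
pose S := [set t | t \in `[a, b] /\ (s%:E <= arc_length alpha a t)%E].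
have Sb : S b by split => //; rewrite in_itv/= ab lexx.
have Slb : lbound S a by move=> t [+ _]; rewrite in_itv/= => /andP[].
have hS : has_inf S by split; [exists b|exists a].
pose t0 := inf S.
have at0 : a <= t0 by apply: lb_le_inf => //; exists b.
have t0b : t0 <= b by apply: ge_inf => //; exists a.
have t0ab : t0 \in `[a, b] by rewrite in_itv/= at0.
have tlt t : a <= t < t0 -> (arc_length alpha a t < s%:E)%E.
  move=> /andP[at_ tt0]; rewrite ltNge; apply/negP => H.
  have : t0 <= t by apply: ge_inf; [exists a|split => //; rewrite in_itv/= at_ (le_trans (ltW tt0))].
  by rewrite leNgt tt0.
have tgt t : t0 < t <= b -> (s%:E <= arc_length alpha a t)%E.
  move=> /andP[t0t tb]; have [u [uab us] ut] := inf_lt hS.1 t0t.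
  have au : a <= u by move: uab; rewrite in_itv/= => /andP[].
  apply: (le_trans us); rewrite (@arc_length_add _ a u t) ?(ltW ut)//.
    by rewrite leeDl// arc_length_ge0// ltW.
  apply: le_lt_trans (fin); rewrite (@arc_length_add _ a t b)// ?(le_trans at0 (ltW t0t))//.
  by rewrite leeDl// arc_length_ge0.
have finat t : a <= t <= b -> arc_length alpha a t \is a fin_num.
  move=> /andP[at_ tb]; rewrite ge0_fin_numE ?arc_length_ge0//.
  apply: le_lt_trans (fin); rewrite (@arc_length_add _ a t b)//.
  by rewrite leeDl// arc_length_ge0.
have addt t : a <= t <= b -> arc_length alpha t b = (arc_length alpha a b - arc_length alpha a t)%E.
  move=> tab; have /andP[at_ tb] := tab.
  by rewrite (@arc_length_add _ a t b)// [X in (X - _)%E]addeC addeK// finat.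
have le_s : (arc_length alpha a t0 <= s%:E)%E.
  move: at0; rewrite le_eqVlt => /predU1P[at0|at0].
    by rewrite -at0; apply: arc_length_le => r /itv_partitionxx ->.
  apply: arc_length_le_left => //; last by move=> t /tlt/ltW.
  move=> e e0; have [d d0 H] := within_continuous_dist ca t0ab e0.
  exists d => // t /andP[at_ tt0] td; apply: H.
    by rewrite in_itv/= at_ (le_trans (ltW tt0)).
  by rewrite ger0_norm// subr_ge0 ltW.
have le_r : (arc_length alpha t0 b <= (fine (arc_length alpha a b) - s)%:E)%E.
  move: (t0b); rewrite le_eqVlt => /predU1P[t0b'|t0b'].
    rewrite t0b'; apply: arc_length_le => r /itv_partitionxx ->/=.
    by rewrite lee_fin subr_ge0 -lee_fin fineK.
  apply: arc_length_le_right => //.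
    move=> e e0; have [d d0 H] := within_continuous_dist ca t0ab e0.
    exists d => // t /andP[t0t tb] td; apply: H.
      by rewrite in_itv/= tb (le_trans at0 (ltW t0t)).
    by rewrite distrC ger0_norm// subr_ge0 ltW.
  move=> t tab; have /andP[t0t tb] := tab.
  rewrite addt ?tb ?(le_trans at0 (ltW t0t))// EFinB fineK// leeB//.
  exact: tgt.
have Es : arc_length alpha a t0 = s%:E.
  apply/eqP; rewrite eq_le le_s/=.
  have := le_r; rewrite addt ?at0// -(fineK (finat t0 _)) ?at0// -(fineK finl).
  rewrite -EFinB !lee_fin; lra.
by exists t0; split => //; rewrite addt ?at0// Es.
Qed.

End arc_length.

(** * The quasihyperbolic distance along arcs *)

Section integral_bounds.
Context {R : realType}.
Let mu := @lebesgue_measure R.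

(* Unlike the library's ge0_le_integral, no measurability is required. *)
Lemma ge0_le_integral_any (A : set R) (f g : R -> \bar R) :
  (forall x, A x -> 0 <= f x)%E -> (forall x, A x -> f x <= g x)%E ->
  (\int[mu]_(x in A) f x <= \int[mu]_(x in A) g x)%E.
Proof.
move=> f0 fg; rewrite !ge0_integralE//; last first.
  by move=> x Ax; apply: le_trans (fg x Ax); exact: f0.
apply: le_ereal_sup => _ [h /= hf <-]; exists h => //= x.
apply: le_trans (hf x) _; rewrite /patch; case: ifPn => // xA.
by apply: fg; rewrite inE in xA.
Qed.

(** The two terms serve to compare the density [1 / d] along an arc with the distances to its two
    ends. *)
Lemma integral_two_poles (p q u v l : R) : 0 < u -> 0 < v -> 0 <= l ->
  (\int[mu]_(s in `[0%R, l]) (p / (u + s) + q / (v + (l - s)))%:E =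
   (p * ln ((u + l) / u) + q * ln ((v + l) / v))%:E)%E.
Proof.
move=> u0 v0; rewrite le_eqVlt => /predU1P[<-|l0].
  by rewrite set_itv1 integral_set1 !addr0 !divff ?gt_eqF// ln1 !mulr0 addr0.
pose F s := p * ln (u + s) - q * ln (v + (l - s)).
have dF (s : R) : 0 <= s <= l ->
    is_derive s 1 F (p / (u + s) + q / (v + (l - s))).
  move=> /andP[s0 sl].
  have us : 0 < u + s by lra.
  have vs : 0 < v + (l - s) by lra.

  have d1 : is_derive s 1 (fun s => ln (u + s)) (u + s)^-1.
    have e1 : is_derive s 1 (cst u + id) 1.
      by apply: is_derive_eq; rewrite add0r.
    have us' : 0 < (cst u + id) s := us.
    have := @is_derive1_comp _ (@ln R) _ s _ _ (is_derive1_ln us') e1.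
    by rewrite mulr1; apply.
  have d2 : is_derive s 1 (fun s => ln (v + (l - s))) (- (v + (l - s))^-1).
    have e2 : is_derive s 1 (cst v + (cst l - id)) (-1).
      have := is_deriveD (is_derive_cst v s 1)
        (is_deriveB (is_derive_cst l s 1) (is_derive_id s 1)).
      by rewrite sub0r add0r.
    have vs' : 0 < (cst v + (cst l - id)) s := vs.
    have := @is_derive1_comp _ (@ln R) _ s _ _ (is_derive1_ln vs') e2.
    by rewrite mulrN1; apply.
  rewrite (_ : F = p *: (fun s => ln (u + s)) - q *: (fun s => ln (v + (l - s))))//.
  apply: is_derive_eq; rewrite /GRing.scale/=; ring.
have cF (s : R) : 0 <= s <= l -> {for s, continuous F}.
  move=> /dF [dFs _]; apply/differentiable_continuous.
  exact/derivable1_diffP.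
rewrite (@continuous_FTC2 _ _ F)//.
- rewrite -EFinB; congr (_%:E); rewrite /F subrr subr0 !addr0 !ln_div ?posrE; lra.
- apply: continuous_in_subspaceT => s; rewrite inE/= in_itv/= => /andP[s0 sl].
  have us : u + s != 0 by apply/eqP; lra.
  have vs : v + (l - s) != 0 by apply/eqP; lra.
  apply: cvgD; apply: cvgM; do ?exact: cvg_cst; apply: cvgV => //.
    by apply: cvgD; [exact: cvg_cst|exact: cvg_id].
  apply: cvgD; first exact: cvg_cst.
  by apply: cvgB; [exact: cvg_cst|exact: cvg_id].
- split.
  + move=> s; rewrite in_itv/= => /andP[s0 sl].
    by have [] := dF s; first by rewrite !ltW.
  + by apply: cvg_at_right_filter; apply: cF; rewrite lexx ltW.
  + by apply: cvg_at_left_filter; apply: cF; rewrite lexx ltW.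
- move=> s; rewrite in_itv/= => /andP[s0 sl].
  by rewrite derive1E; apply: derive_val; apply: dF; rewrite !ltW.
Qed.
End integral_bounds.

Section quasihyperbolic_bounds.
Context {R : realType} {E : normedModType R}.
Variable (D : set E).
Local Notation d := (boundary_dist D).
Hypothesis d_gt0 : forall z, D z -> 0 < d z.
Hypothesis d_lip : forall x y, D x -> D y -> d x <= d y + `|x - y|.

Lemma arclength_param_dist alpha a b (x y : E) (s : R) :
  arc_joins D alpha a b x y -> 0 <= s <= fine (arc_length alpha a b) ->
  exists t, [/\ t \in `[a, b], arclength_param alpha a b s = alpha t,
    D (alpha t), arc_length alpha a t = s%:E /\
      arc_length alpha t b = (fine (arc_length alpha a b) - s)%:E &
    `|x - alpha t| <= s /\ `|y - alpha t| <= fine (arc_length alpha a b) - s].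
Proof.
move=> [ra aD <- <-] /andP[s0 sl]; have [ab _ _ fin] := ra.
have finl : arc_length alpha a b \is a fin_num.
  by rewrite ge0_fin_numE// arc_length_ge0.
have [|t [tab pE l1 l2]] := arclength_paramP ra s0.
  by rewrite -(fineK finl) lee_fin.
have /andP[at_ tb] : a <= t <= b by move: tab; rewrite in_itv.
move: l2; rewrite -{1}(fineK finl) -EFinB => l2.
exists t; split => //; first by apply: aD; exists t.
by rewrite -!lee_fin -l1 -l2 distrC; split; exact: norm_le_arc_length.
Qed.

(** The point at arc length [s] is within [s] of [x], so its boundary distance is at most [d x + s];
    the reciprocal integrates to a logarithm. *)
Lemma arc_integral_ge alpha a b (x y : E) : arc_joins D alpha a b x y ->
  ((ln (1 + `|x - y| / d x))%:E <=
   arc_integral (fun z => (d z)^-1)%R alpha a b)%E.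
Proof.
move=> j; have [ra aD ax yb] := j; have [ab _ _ fin] := ra.
have finl : arc_length alpha a b \is a fin_num.
  by rewrite ge0_fin_numE// arc_length_ge0.
have Dx : D x by rewrite -ax; apply: aD; exists a => //=; rewrite in_itv/= lexx.
have dx := d_gt0 Dx.
set l := fine (arc_length alpha a b).
have l0 : 0 <= l by rewrite fine_ge0// arc_length_ge0.
have xyl : `|x - y| <= l.
  by rewrite -lee_fin fineK// -ax -yb distrC norm_le_arc_length.
(* The second pole has coefficient 0, and its position 1 is arbitrary. *)
have := @integral_two_poles R 1 0 (d x) 1 l dx ltr01 l0.
rewrite !mul0r addr0 mul1r => I.
apply: (@le_trans _ _ (ln ((d x + l) / d x))%:E).
  rewrite lee_fin ler_ln ?posrE; last 2 first.
  - by rewrite ltr_pwDl// divr_ge0// ltW.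
  - by rewrite divr_gt0// ltr_pwDl.
  by rewrite mulrDl divff ?gt_eqF// lerD2l ler_pM2r// invr_gt0.
rewrite -I; apply: ge0_le_integral_any => s /=; rewrite in_itv/= => /andP[s0 sl].
  by rewrite lee_fin mul0r addr0 divr_ge0// addr_ge0// ltW.
have [|t [tab -> Dt _ [xt _]]] := arclength_param_dist j (s := s).
  by rewrite s0.
rewrite lee_fin mul0r addr0 mul1r lef_pV2 ?posrE ?d_gt0//; last by rewrite ltr_pwDl.
rewrite (le_trans (d_lip Dt Dx))// distrC; lra.
Qed.

(** At each point [z] of the arc the cigar condition holds for one of the ends. If it is [x], at arc
    length [s <= c * d z], then [d x + s <= d z + 2 * s <= 3 * c * d z], so the pole at [x]
    dominates the density there; the pole at [y] adds a nonnegative term. *)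
Lemma arc_integral_le (c : R) alpha a b (x y : E) : 1 <= c ->
  arc_joins D alpha a b x y ->
  (forall t, t \in `[a, b] ->
    (Order.min (arc_length alpha a t) (arc_length alpha t b)
       <= (c * d (alpha t))%:E)%E) ->
  (arc_length alpha a b <= (c * `|x - y|)%:E)%E ->
  (arc_integral (fun z => (d z)^-1)%R alpha a b <=
   (3 * c * (ln (1 + c * `|x - y| / d x) + ln (1 + c * `|x - y| / d y)))%:E)%E.
Proof.
move=> c1 j cig lc; have [ra aD ax yb] := j; have [ab _ _ fin] := ra.
have finl : arc_length alpha a b \is a fin_num.
  by rewrite ge0_fin_numE// arc_length_ge0.
have Dx : D x by rewrite -ax; apply: aD; exists a => //=; rewrite in_itv/= lexx.
have Dy : D y by rewrite -yb; apply: aD; exists b => //=; rewrite in_itv/= lexx ab.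
have dx := d_gt0 Dx; have dy := d_gt0 Dy.
set l := fine (arc_length alpha a b).
have l0 : 0 <= l by rewrite fine_ge0// arc_length_ge0.
have {}lc : l <= c * `|x - y| by rewrite -lee_fin fineK.
have H z : D z -> ln ((d z + l) / d z) <= ln (1 + c * `|x - y| / d z).
  move=> Dz; have dz := d_gt0 Dz.
  rewrite ler_ln ?posrE; last 2 first.
  - by rewrite divr_gt0// ltr_pwDl.
  - by rewrite ltr_pwDl// divr_ge0// ?(ltW dz)// (le_trans l0).
  by rewrite mulrDl divff ?gt_eqF// lerD2l ler_pM2r// invr_gt0.
apply: (@le_trans _ _ (3 * c * ln ((d x + l) / d x) + 3 * c * ln ((d y + l) / d y))%:E);
  last first.
  by rewrite lee_fin -mulrDr ler_pM2l ?lerD ?H//; lra.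
rewrite -integral_two_poles//; apply: ge0_le_integral_any => s /=;
  rewrite in_itv/= => /andP[s0 sl];
  have [|t [tab -> Dt [l1 l2] [xt yt]]] := arclength_param_dist j (s := s); rewrite ?s0//.
  by rewrite lee_fin invr_ge0 ltW// d_gt0.
have dt := d_gt0 Dt; have := cig t tab; rewrite l1 l2 -/l; rewrite -/l in yt.
have Pge0 (w : R) : 0 <= w -> 0 <= 3 * c / w by move=> w0; rewrite divr_ge0//; lra.
have Q (w : R) : 0 < w -> w <= 3 * c * d (alpha t) -> (d (alpha t))^-1 <= 3 * c / w.
  by move=> w0 wd; rewrite ler_pdivlMr// mulrC ler_pdivrMr.
have dtc : d (alpha t) <= c * d (alpha t) by rewrite ler_peMl// ltW.
have xs : 0 < d x + s by rewrite ltr_pwDl.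
have ys : 0 < d y + (l - s) by rewrite ltr_pwDl// subr_ge0.
rewrite ge_min !lee_fin => /orP[] K.
- have L := d_lip Dx Dt; rewrite (le_trans (Q _ xs _)) ?lerDl ?Pge0 ?(ltW ys)//.
  lra.
- have L := d_lip Dy Dt; rewrite (le_trans (Q _ ys _)) ?lerDr ?Pge0 ?(ltW xs)//.
  lra.
Qed.

(** The lower bound holds for every arc, the upper one for the arc that uniformity provides.
    Together they make the infimum finite, so that [fine] does not alter it. *)
Lemma quasihyperbolic_bounds (c : R) (x y : E) : 1 <= c -> uniform_domain c D ->
  D x -> D y ->
  ln (1 + `|x - y| / d x) <= quasihyperbolic D x y <=
  3 * c * (ln (1 + c * `|x - y| / d x) + ln (1 + c * `|x - y| / d y)).
Proof.
move=> c1 u Dx Dy.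
rewrite /quasihyperbolic; set S := (X in ereal_inf X).
have lo : ((ln (1 + `|x - y| / d x))%:E <= ereal_inf S)%E.
  by apply: le_ereal_inf_tmp => _ [al [a [b [j ->]]]]; exact: arc_integral_ge.
have hi : (ereal_inf S <= (3 * c * (ln (1 + c * `|x - y| / d x) +
    ln (1 + c * `|x - y| / d y)))%:E)%E.
  have [al [a [b [j cig lc]]]] := u x y Dx Dy.
  apply: le_trans (arc_integral_le c1 j cig lc).
  by apply: ereal_inf_lbound; exists al, a, b.
have finS : ereal_inf S \is a fin_num.
  rewrite fin_real// (lt_le_trans _ lo) ?ltNyr//=.
  by rewrite (le_lt_trans hi) ?ltry.
by rewrite -!lee_fin fineK// lo.
Qed.

End quasihyperbolic_bounds.

(** * Distance to the boundary and corkscrew points *)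

Section finite_boundary.
Context {R : realType} {E : normedModType R}.
Implicit Types (D : set E) (x y z w : E).

Definition finite_boundary D : set E := closure D `\` D.

Lemma closure_dist D x : closure D x <->
  forall e, 0 < e -> exists2 z, D z & `|x - z| < e.
Proof.
split=> [cx e e0|H U /nbhs_ballP[e /= e0 eU]].
  have [z [Dz]] := cx _ (nbhsx_ballx x e e0).
  by rewrite -ball_normE => ?; exists z.
have [z Dz xz] := H _ e0; exists z; split => //; apply: eU.
by rewrite -ball_normE.
Qed.

Lemma nbhs_fin_pt x (V : set (infty_extension E)) :
  nbhs (fin_pt x) V = nbhs x (@fin_pt R E @^-1` V).
Proof. by []. Qed.

Lemma ext_closure_fin D x : ext_closure D (fin_pt x) <-> closure D x.
Proof.
split=> cx U xU; last first.
  by have [z [Dz Uz]] := cx _ xU; exists (fin_pt z); split => //; exists z.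
have [|_ [[z Dz <-] [w Uw [wz]]]] := cx (@fin_pt R E @` U).
  by rewrite nbhs_fin_pt; apply: filterS xU => w Uw; exists w.
by exists z; split => //; rewrite -wz.
Qed.

Lemma ext_boundary_fin D x : open D ->
  ext_boundary D (fin_pt x) <-> finite_boundary D x.
Proof.
move=> oD; split=> -[/ext_closure_fin cx nx]; split => // H; apply: nx.
- apply: (filterS _ (open_nbhs_nbhs (conj oD H))) => z Dz.
  by exists z.
- by have [z Dz [<-]] := nbhs_singleton H.
Qed.

Lemma boundary_distE D z : open D ->
  boundary_dist D z = inf [set `|z - w| | w in finite_boundary D].
Proof.
move=> oD; congr (inf [set _ | _ in _]).
by apply/funext => w; apply/propext; exact: ext_boundary_fin.
Qed.

(** Take the infimum of the parameters outside [D]: earlier points lie in [D], so the point is in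
    the closure, and openness keeps it out of [D]. *)
Lemma segment_boundary D x y : open D -> D x -> ~ D y ->
  exists s : R, 0 <= s <= 1 /\ finite_boundary D (x + s *: (y - x)).
Proof.
move=> oD Dx nDy.
pose S := [set s : R | 0 <= s <= 1 /\ ~ D (x + s *: (y - x))].
have S1 : S 1 by split; [rewrite ler01 lexx|rewrite scale1r addrC subrK].
have Slb : lbound S 0 by move=> s [/andP[]].
have hS : has_inf S by split; [exists 1|exists 0].
pose s0 := inf S.
have s00 : 0 <= s0 by apply: lb_le_inf => //; exists 1.
have s01 : s0 <= 1 by apply: ge_inf => //; exists 0.
have cts (s t : R) : `|(x + s *: (y - x)) - (x + t *: (y - x))| = `|s - t| * `|y - x|.
  by rewrite opprD addrACA subrr add0r -scalerBl normrZ.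
have nyx : 0 < `|y - x| + 1 by rewrite ltr_wpDl.
exists s0; split; first by rewrite s00.
have close (e : R) : 0 < e -> exists2 h, 0 < h &
    forall s t : R, `|s - t| < h -> `|(x + s *: (y - x)) - (x + t *: (y - x))| < e.
  move=> e0; exists (e / (`|y - x| + 1)); first by rewrite divr_gt0.
  move=> s t st; rewrite cts; apply: (@le_lt_trans _ _ (`|s - t| * (`|y - x| + 1))).
    by rewrite ler_wpM2l// lerDl.
  by rewrite -ltr_pdivlMr.
have Ds (s : R) : 0 <= s < s0 -> D (x + s *: (y - x)).
  move=> /andP[s_0 ss0]; apply: contrapT => nD.
  have : s0 <= s by apply: ge_inf; [exists 0|split => //; rewrite s_0 (le_trans (ltW ss0))].
  by rewrite leNgt ss0.
split; last first.
  move=> D0; have := open_nbhs_nbhs (conj oD D0) => /nbhs_ballP[e /= e0 eD].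
  have [h h0 H] := close _ e0.
  have s0h : s0 < s0 + h by rewrite ltrDl.
  have [s [s1 nDs] ssh] := inf_lt hS.1 s0h; apply: (nDs); apply: eD.
  rewrite -ball_normE; apply: H; rewrite distrC ger0_norm; first lra.
  by rewrite subr_ge0; apply: ge_inf; [exists 0|split].
apply/closure_dist => e e0; have [h h0 H] := close _ e0.
move: s00; rewrite le_eqVlt => /predU1P[s00|s00].
  by exists x => //; rewrite -s00 scale0r addr0 subrr normr0.
exists (x + Num.max 0 (s0 - h / 2) *: (y - x)).
  by apply: Ds; rewrite le_max lexx/= gt_max s00/=; lra.
apply: H; rewrite ger0_norm ?subr_ge0 ?ge_max ?(ltW s00)/=; last lra.
have : s0 - h / 2 <= Num.max 0 (s0 - h / 2) by rewrite le_max lexx orbT.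
lra.
Qed.

Lemma finite_boundary_neq0 D : open D -> D !=set0 -> D <> setT ->
  finite_boundary D !=set0.
Proof.
move=> oD [x Dx] DT; have [y nDy] : exists y, ~ D y.
  by apply/existsNP => H; apply: DT; apply/seteqP; split.
by have [s [_ ?]] := segment_boundary oD Dx nDy; exists (x + s *: (y - x)).
Qed.

Section distance.
Variable D : set E.
Hypotheses (oD : open D) (D0 : D !=set0) (DT : D <> setT).
Local Notation d := (boundary_dist D).
Local Notation B := (finite_boundary D).

Let img z := [set `|z - w| | w in B].
Let img0 z : img z !=set0.
Proof. by have [b Bb] := finite_boundary_neq0 oD D0 DT; exists `|z - b|; exists b. Qed.
Let imglb z : has_lbound (img z).
Proof. by exists 0 => _ [w _ <-]. Qed.

Lemma boundary_dist_le z b : B b -> d z <= `|z - b|.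
Proof. by move=> Bb; rewrite boundary_distE//; apply: ge_inf; [exact: imglb|exists b]. Qed.

Lemma boundary_dist_ge z (e : R) : (forall b, B b -> e <= `|z - b|) -> e <= d z.
Proof.
by move=> H; rewrite boundary_distE//; apply: lb_le_inf; [exact: img0|move=> _ [b Bb <-]; exact: H].
Qed.

Lemma boundary_dist_gt0 z : D z -> 0 < d z.
Proof.
move=> Dz; have /nbhs_ballP[e /= e0 eD] := open_nbhs_nbhs (conj oD Dz).
apply: (lt_le_trans e0); apply: boundary_dist_ge => b [_ nDb].
by rewrite leNgt; apply/negP => H; apply: nDb; apply: eD; rewrite -ball_normE.
Qed.

Lemma boundary_dist_lip x y : d x <= d y + `|x - y|.
Proof.
rewrite -lerBlDr; apply: boundary_dist_ge => b Bb.
by have := ler_distD y x b; have := boundary_dist_le x Bb; lra.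
Qed.

(** In infinite dimension the distance need not be attained, hence the factor 2. *)
Lemma boundary_dist_attained z : D z -> exists2 b, B b & `|z - b| <= 2 * d z.
Proof.
move=> /boundary_dist_gt0 d0; have dd : d z < 2 * d z by lra.
move: (dd); rewrite {1}boundary_distE// => /(inf_lt (img0 z))[_ [b Bb <-]] H.
by exists b => //; exact: ltW.
Qed.

Lemma closure_boundary x : closure D x -> D x \/ B x.
Proof. by move=> cx; have [|nDx] := pselect (D x); [left|right]. Qed.

End distance.
End finite_boundary.

Section corkscrew.
Context {R : realType} {E : normedModType R}.

(** The interior corkscrew condition; the point [z] limits the scale, since [D] may be bounded. *)
Definition corkscrew (C : R) (D : set E) : Prop :=
  forall b z s, finite_boundary D b -> D z -> 0 < s -> 4 * s <= `|z - b| ->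
  exists p, [/\ D p, `|p - b| <= 2 * s & s <= C * boundary_dist D p].

(** Join a point [z0] of [D] close to [b] to [z] by a cigar arc. A point of the arc at distance
    exactly [s] from [z0] is also at distance at least [s] from [z], so both subarcs are at least
    [s] long. *)
Lemma uniform_corkscrew (c : R) (D : set E) : uniform_domain c D -> corkscrew c D.
Proof.
move=> u b z s [cb _] Dz s0 sz.
have s20 : 0 < s / 2 by lra.
have [z0 Dz0 bz0] := (closure_dist D b).1 cb _ s20.
have [al [a [e [[[ae ca _ _] aD aa ee] cig _]]]] := u _ _ Dz0 Dz.
pose g t := `|al t - z0|.
have cg : {within `[a, e], continuous g}.
  apply/subspace_continuousP => t tae; apply: cvg_norm; apply: cvgB; last exact: cvg_cst.
  by have /subspace_continuousP := ca; apply.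
have zz0 : `|z - b| <= `|z - z0| + `|z0 - b| by exact: ler_distD.
rewrite distrC in bz0.
have [|t tae gt] := @IVT _ g a e s ae cg.
  rewrite /g aa ee subrr normr0 ge_min le_max ltW//=; apply/orP; right; lra.
have /andP[at_ te] : a <= t <= e by move: tae; rewrite in_itv.
exists (al t); split; first by apply: aD; exists t.
  have : `|al t - b| <= `|al t - z0| + `|z0 - b| by exact: ler_distD.
  rewrite /g in gt; lra.
rewrite -lee_fin; apply: le_trans (cig t tae); rewrite le_min.
have n1 := norm_le_arc_length al at_; have n2 := norm_le_arc_length al te.
rewrite aa in n1; rewrite ee in n2; rewrite (le_trans _ n1) ?lee_fin -?gt//=.
apply: le_trans n2; rewrite lee_fin gt.
have : `|z - z0| <= `|z - al t| + `|al t - z0| by exact: ler_distD.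
rewrite /g in gt; lra.
Qed.

End corkscrew.

(** * The distance ratio metric *)

Section relative_distance.
Context {R : realType} {E : normedModType R}.
Implicit Types (D : set E) (x y z : E).

Definition proper_open D : Prop := [/\ D !=set0, open D & D <> setT].

(* [ln (relative_distance D x y)] is the distance ratio metric j_D. *)
Definition relative_distance D x y : R :=
  1 + `|x - y| / Num.min (boundary_dist D x) (boundary_dist D y).

Variable D : set E.
Hypothesis hD : proper_open D.
Local Notation d := (boundary_dist D).
Local Notation J := (relative_distance D).

Lemma dist_gt0 z : D z -> 0 < d z.
Proof. by case: hD => D0 oD DT; exact: boundary_dist_gt0. Qed.

Lemma min_dist_gt0 x y : D x -> D y -> 0 < Num.min (d x) (d y).
Proof. by move=> Dx Dy; rewrite lt_min !dist_gt0. Qed.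

Lemma relative_distC x y : J x y = J y x.
Proof. by rewrite /relative_distance distrC minC. Qed.

Lemma relative_dist_ge1 x y : D x -> D y -> 1 <= J x y.
Proof. by move=> Dx Dy; rewrite lerDl divr_ge0// ltW// min_dist_gt0. Qed.

Lemma relative_dist_norm x y a : D x -> D y -> J x y <= a ->
  `|x - y| <= a * Num.min (d x) (d y).
Proof.
move=> Dx Dy Ja; rewrite -ler_pdivrMr ?min_dist_gt0//.
by apply: le_trans Ja; rewrite lerDr.
Qed.

Lemma relative_dist_le x y (e r : R) : 0 < e -> e <= d x -> e <= d y ->
  `|x - y| <= r -> J x y <= 1 + r / e.
Proof.
move=> e0 ex ey xyr; rewrite lerD2l.
have em : e <= Num.min (d x) (d y) by rewrite le_min ex.
have m0 := lt_le_trans e0 em.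
by rewrite ler_pM ?invr_ge0 ?(ltW m0)// lef_pV2 ?posrE.
Qed.

Lemma relative_dist_ratio x y : D x -> D y -> d x <= J x y * d y.
Proof.
move=> Dx Dy; case: hD => D0 oD DT.
apply: le_trans (boundary_dist_lip oD D0 DT x y) _.
rewrite mulrDl mul1r lerD2l mulrAC ler_pdivlMr ?min_dist_gt0// ler_wpM2l//.
by rewrite ge_min lexx orbT.
Qed.

End relative_distance.

Section relative_control.
Context {R : realType} {E E' : normedModType R}.

(** Bernoulli's inequality; it moves a constant from inside a logarithm to the front of it. *)
Lemma bernoulli_scale (u c : R) n : 0 <= u -> c <= n%:R -> 1 + c * u <= (1 + u) ^+ n.
Proof.
move=> u0 cn; apply: (@le_trans _ _ (1 + n%:R * u)).
  by rewrite lerD2l ler_wpM2r.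
elim: n {cn} => [|n IH]; first by rewrite mul0r addr0 expr0.
rewrite exprS; have : (1 + u) * (1 + n%:R * u) <= (1 + u) * (1 + u) ^+ n.
  by rewrite ler_wpM2l// addr_ge0.
apply: le_trans; rewrite -natr1.
have : 0 <= n%:R * (u * u) by rewrite !mulr_ge0.
nra.
Qed.

(** With j the logarithm of the relative distance, the quasihyperbolic distance in [D] is at most
    [6 * c * n] times j, which gives the exponent [m]. The lower bound in [D'] involves the boundary
    distance of the first point, so both orders of the points are used to reach the minimum. *)
Lemma relative_distance_control (c M : R) (n m : nat) (D : set E) (D' : set E')
    (x y : E) (x' y' : E') :
  1 <= c -> 0 <= M -> c <= n%:R -> 6 * M * c * n%:R <= m%:R ->
  proper_open D -> proper_open D' -> uniform_domain c D -> uniform_domain c D' ->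
  D x -> D y -> D' x' -> D' y' ->
  quasihyperbolic D' x' y' <= M * quasihyperbolic D x y ->
  quasihyperbolic D' y' x' <= M * quasihyperbolic D y x ->
  relative_distance D' x' y' <= relative_distance D x y ^+ m.
Proof.
move=> c1 M0 cn cm hD hD' uD uD'.
have main (u v : E) (u' v' : E') : D u -> D v -> D' u' -> D' v' ->
    quasihyperbolic D' u' v' <= M * quasihyperbolic D u v ->
    1 + `|u' - v'| / boundary_dist D' u' <= relative_distance D u v ^+ m.
  move=> Du Dv Du' Dv' k; case: (hD) => D0 oD DT; case: (hD') => D0' oD' DT'.
  have := quasihyperbolic_bounds (boundary_dist_gt0 oD D0 DT)
    (fun z w _ _ => boundary_dist_lip oD D0 DT z w) c1 uD Du Dv.
  have := quasihyperbolic_bounds (boundary_dist_gt0 oD' D0' DT')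
    (fun z w _ _ => boundary_dist_lip oD' D0' DT' z w) c1 uD' Du' Dv'.
  move=> /andP[lo _] /andP[_ hi].
  have J1 := relative_dist_ge1 hD Du Dv.
  have J0 : 0 < relative_distance D u v by rewrite (lt_le_trans _ J1).
  have H (z : E) : D z -> Num.min (boundary_dist D u) (boundary_dist D v) <= boundary_dist D z ->
      ln (1 + c * `|u - v| / boundary_dist D z) <= n%:R * ln (relative_distance D u v).
    move=> Dz zm; have dz := dist_gt0 hD Dz; have mz := min_dist_gt0 hD Du Dv.
    have cu : 0 <= c * `|u - v| by rewrite mulr_ge0//; lra.
    rewrite mulr_natl -lnXn// ler_ln ?posrE ?exprn_gt0//; last first.
      by rewrite ltr_pwDl// divr_ge0// ltW.
    apply: le_trans (bernoulli_scale _ cn); last by rewrite divr_ge0// ltW.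
    by rewrite lerD2l mulrA ler_wpM2l// lef_pV2.
  have Hu := H u Du; have Hv := H v Dv; rewrite !ge_min !lexx ?orbT in Hu Hv.
  have {}Hu := Hu isT; have {}Hv := Hv isT.
  set l := ln (relative_distance D u v) in Hu Hv.
  have l0 : 0 <= l by rewrite ln_ge0.
  have dpos : 0 < 1 + `|u' - v'| / boundary_dist D' u'.
    by rewrite ltr_pwDl// divr_ge0// ltW// (dist_gt0 hD').
  rewrite -ler_ln ?posrE ?exprn_gt0// lnXn// -mulr_natl -/l.
  apply: (le_trans lo); apply: (le_trans k).
  apply: (@le_trans _ _ (6 * M * c * n%:R * l)); last by rewrite ler_wpM2r.
  apply: (@le_trans _ _ (M * (3 * c * (n%:R * l + n%:R * l)))).
    rewrite ler_wpM2l//; apply: (le_trans hi); rewrite ler_wpM2l ?lerD//; lra.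
  by rewrite le_eqVlt; apply/orP; left; apply/eqP; ring.
move=> Dx Dy Dx' Dy' k1 k2.
rewrite {1}/relative_distance; have [xy|yx] := leP (boundary_dist D' x') (boundary_dist D' y').
  exact: main.
by rewrite distrC relative_distC; exact: main.
Qed.

End relative_control.

(** * Images of descending sequences *)

Section sequences.
Context {R : realType} {E : normedModType R}.
Local Notation h := (2^-1 : R).

Lemma geometric_tail (w : nat -> E) (P S : R) (n0 K : nat) : 0 <= S ->
  (forall k, (k <= n0)%N -> (k <= K)%N -> `|w 0%N - w k| <= P) ->
  (forall k, (k < K)%N -> `|w k - w k.+1| <= S * h ^+ k) ->
  forall k, (k <= K)%N -> `|w 0%N - w k| <= P + 2 * S * h ^+ n0.
Proof.
move=> S0 near step k kK.
have hp i : 0 <= h ^+ i by rewrite exprn_ge0// invr_ge0.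
have [kn|nk] := leqP k n0.
  by rewrite (le_trans (near k kn kK))// lerDl !mulr_ge0.
rewrite -(subnKC (ltnW nk)); have : (n0 + (k - n0) <= K)%N by rewrite subnKC// ltnW.
elim: (k - n0)%N => [|j IH] jK.
  by rewrite addn0 (le_trans (near n0 _ _)) ?lerDl ?mulr_ge0//; lia.
(* The induction runs on the exact partial sum of the geometric series. *)
suff H i : (n0 + i <= K)%N ->
    `|w 0%N - w (n0 + i)%N| <= P + 2 * S * (h ^+ n0 - h ^+ (n0 + i)).
  rewrite (le_trans (H _ jK))// lerD2l ler_wpM2l ?mulr_ge0//.
  by rewrite gerBl.
elim: i => [|i IHi] iK.
  by rewrite addn0 subrr mulr0 addr0 near//; lia.
have K1 : (n0 + i < K)%N by lia.
have := ler_distD (w (n0 + i)%N) (w 0%N) (w (n0 + i.+1)%N).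
have := step _ K1; have := IHi (ltnW K1); rewrite addnS exprS.
have := hp (n0 + i)%N; set a := h ^+ (n0 + i); set b := h ^+ n0.
lra.
Qed.

Lemma range_argmax (u : nat -> R) (N n : nat) : (N <= n)%N ->
  exists2 i, (N <= i <= n)%N & forall j, (N <= j <= n)%N -> u j <= u i.
Proof.
move=> Nn; rewrite -(subnKC Nn); elim: (n - N)%N => [|k [i Hi IH]].
  exists N; rewrite ?addn0 ?leqnn// => j jN.
  by have -> : j = N by lia.
have [le|lt] := leP (u (N + k.+1)%N) (u i).
  exists i; first lia.
  move=> j jN; have [->//|jk] := eqVneq j (N + k.+1)%N.
  by apply: IH; lia.
exists (N + k.+1)%N; first lia.
move=> j jN; have [->//|jk] := eqVneq j (N + k.+1)%N.
by rewrite (le_trans _ (ltW lt))// IH//; lia.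
Qed.

(* The index maximizing delta is the turning point: on both sides of it delta
   decays geometrically. *)
Lemma turning_point (v : nat -> E) (delta : nat -> R) (A A2 Q : R) (n0 N n : nat) :
  0 <= A -> 0 <= Q -> (N <= n)%N ->
  (forall i, (N <= i < n)%N ->
     `|v i - v i.+1| <= A * delta i /\ `|v i - v i.+1| <= A * delta i.+1) ->
  (forall i j, (N <= i)%N -> (i <= j <= n)%N -> (j <= i + n0)%N ->
     `|v i - v j| <= A2 * delta i /\ `|v i - v j| <= A2 * delta j) ->
  (forall i j, (N <= i)%N -> (i <= j <= n)%N ->
     delta i <= Q * h ^+ (j - i) \/ delta j <= Q * h ^+ (j - i)) ->
  exists i, [/\ (N <= i <= n)%N, delta N <= delta i &
    `|v N - v n| <= 2 * A2 * delta i + 4 * A * Q * h ^+ n0].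
Proof.
move=> A0 Q0 Nn step near far; have [i Nin imax] := range_argmax delta Nn.
exists i; split => //; first by apply: imax; lia.
have AQ : 0 <= A * Q by rewrite mulr_ge0.
have rt : `|v i - v n| <= A2 * delta i + 2 * (A * Q) * h ^+ n0.
  have -> : n = (i + (n - i))%N by lia.
  rewrite -{1}[i]addn0.
  apply: (@geometric_tail (fun k => v (i + k)%N) _ _ n0 (n - i)) => //.
    move=> k kn kK; rewrite addn0.
    by have [|||H _] := near i (i + k)%N; try lia.
  move=> k kK; have [|st _] := step (i + k)%N; first lia.
  rewrite addnS (le_trans st)// -mulrA ler_wpM2l//.
  (* If the alternative bounds [delta i], maximality passes the bound on to [delta (i + k)]. *)
  have [||H|H] := far i (i + k)%N; try lia.
    by apply: le_trans (imax _ _) _; [lia|move: H; rewrite addKn].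
  by move: H; rewrite addKn.
(* The same estimate with the sequence read backwards from [i]. *)
have lt : `|v i - v N| <= A2 * delta i + 2 * (A * Q) * h ^+ n0.
  have -> : N = (i - (i - N))%N by lia.
  rewrite -{1}[i]subn0.
  apply: (@geometric_tail (fun k => v (i - k)%N) _ _ n0 (i - N)) => //.
    move=> k kn kK; rewrite subn0 distrC.
    by have [|||_ H] := near (i - k)%N i; try lia.
  move=> k kK; have [|_ st] := step (i - k.+1)%N; first lia.
  have E1 : (i - k.+1).+1 = (i - k)%N by lia.
  rewrite E1 distrC in st; rewrite (le_trans st)// -mulrA ler_wpM2l//.
  have E2 : (i - (i - k))%N = k by lia.
  have [||H|H] := far (i - k)%N i; try lia.
    by move: H; rewrite E2.
  by apply: le_trans (imax _ _) _; [lia|move: H; rewrite E2].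
have := ler_distD (v i) (v N) (v n); rewrite (distrC (v N) (v i)).
lra.
Qed.

Lemma last_index (P : pred nat) n : P 0%N -> (forall i, (n <= i)%N -> ~~ P i) ->
  exists2 N, P N & forall i, (N < i)%N -> ~~ P i.
Proof.
move=> P0; elim: n => [|n IH] H; first by have := H 0%N isT; rewrite P0.
have [Pn|nPn] := boolP (P n); first by exists n.
apply: IH => i; rewrite leq_eqVlt => /predU1P[<-//|]; exact: H.
Qed.

End sequences.

(** * Controlled maps and deep image points *)

Section boundary_control.
Context {R : realType}.

(** The form in which the density of the boundary enters the estimates. *)
Definition boundary_spread {E : normedModType R} (rho : R) (D : set E) : Prop :=
  forall x, D x -> exists b1 b2, [/\ finite_boundary D b1, finite_boundary D b2,
    `|x - b1| <= 2 * boundary_dist D x, rho * boundary_dist D x <= `|b1 - b2| &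
    `|b1 - b2| <= boundary_dist D x].

(** What the Lipschitz estimate uses, in a form satisfied both by the map and by its inverse. A
    power bound on the relative distance is a linear bound on its logarithm. *)
Record controlled {E E' : normedModType R} (C L rho : R) (m : nat)
    (D : set E) (D' : set E') (F : E -> E') : Prop := Controlled {
  ctrl_dom : proper_open D;
  ctrl_cod : proper_open D';
  ctrl_map : forall x, D x -> D' (F x);
  ctrl_bdry : forall b, finite_boundary D b -> finite_boundary D' (F b);
  ctrl_cont : forall b e, finite_boundary D b -> 0 < e -> exists2 eta, 0 < eta &
    forall z, D z -> `|z - b| < eta -> `|F z - F b| < e;
  ctrl_lip : forall a b, finite_boundary D a -> finite_boundary D b ->
    `|F a - F b| <= L * `|a - b|;
  ctrl_le : forall x y, D x -> D y ->
    relative_distance D' (F x) (F y) <= relative_distance D x y ^+ m;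
  ctrl_ge : forall x y, D x -> D y ->
    relative_distance D x y <= relative_distance D' (F x) (F y) ^+ m;
  ctrl_corkscrew : corkscrew C D;
  ctrl_spread : boundary_spread rho D }.

Lemma geometric_lt (K e : R) : 0 <= K -> 0 < e ->
  exists n, forall i, (n <= i)%N -> K * 2^-1 ^+ i < e.
Proof.
move=> K0 e0; exists (Num.truncn (K / e)).+1 => i ni.
rewrite exprVn ltr_pdivrMr ?exprn_gt0// mulrC -ltr_pdivrMr//.
apply: (lt_le_trans (truncnS_gt _)); rewrite -natrX ler_nat.
exact: leq_trans ni (ltnW (ltn_expl i (ltnSn 1))).
Qed.

(* A sequence of corkscrew points descending to b is mapped to a discrete
   quasigeodesic ending at F b; where it enters the ball of radius r around
   F b, it comes as far from the boundary as a multiple of r. *)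
Lemma deep_image_point (C : R) (m : nat) : 1 <= C -> (0 < m)%N ->
  exists2 C2 : R, 1 <= C2 & forall (L rho : R) (E E' : normedModType R)
    (D : set E) (D' : set E') (F : E -> E') b z s0 r,
  controlled C L rho m D D' F -> finite_boundary D b -> D z ->
  0 < s0 -> 4 * s0 <= `|z - b| -> 0 < r ->
  exists p s, [/\ D p, 0 < s <= s0, `|p - b| <= 2 * s,
    s <= C * boundary_dist D p & `|F p - F b| <= r /\
    (s = s0 \/ r <= C2 * boundary_dist D' (F p))].
Proof.
move=> C1 m0; pose h : R := 2^-1.
have h0 : 0 < h by rewrite invr_gt0.
have h1 : h <= 1 by rewrite invf_le1// ler1n.
have hp i : 0 < h ^+ i by rewrite exprn_gt0.
(* Bounds the relative distance of the images of two corkscrew points whose indices differ by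
   [k]. *)
pose a k : R := (1 + 4 * C * 2 ^+ (m * k)) ^+ m.
have a0 k : 0 <= a k by rewrite exprn_ge0// addr_ge0// !mulr_ge0//; lra.
pose A := a 1%N.
have A0 : 0 <= A := a0 1%N.
(* Makes the tail term of [turning_point], with [Q = 6 * C * r], at most [r / 4]. *)
have [n0 Hn0] : exists n0 : nat, 96 * A * C * h ^+ n0 <= 1.
  have AC : 0 <= 96 * A * C by rewrite !mulr_ge0//; lra.
  by have [n /(_ _ (leqnn n))/ltW] := geometric_lt AC ltr01; exists n.
have a20 := a0 n0; exists (1 + 2 * (A + 2 * a n0)); first lra.
move=> L rho E E' D D' F b z s0 r ctl Bb Dz s00 s0z r0.
have hD := ctrl_dom ctl; have hD' := ctrl_cod ctl.
(* The scales shrink by [2 ^+ m] at each step, so that the [m]-th root taken for the images leaves a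
   decay by the factor 2. *)
pose sc i := s0 * h ^+ (m * i).
have sc0 i : 0 < sc i by rewrite mulr_gt0.
have sc_le i : sc i <= s0 by rewrite ler_piMr ?(ltW s00)// exprn_ile1// ltW.
have /choice[p Hp] : forall i, exists p, [/\ D p, `|p - b| <= 2 * sc i &
    sc i <= C * boundary_dist D p].
  move=> i; apply: (ctrl_corkscrew ctl Bb Dz (sc0 i)).
  by apply: le_trans s0z; rewrite ler_wpM2l.
have Dp i : D (p i) by case: (Hp i).
pose v i := F (p i); pose delta i := boundary_dist D' (v i).
have D'v i : D' (v i) by apply: (ctrl_map ctl).
have delta0 i : 0 < delta i by exact: dist_gt0.
have [D0' oD' DT'] := hD'.
have Bb' := ctrl_bdry ctl Bb.
have delta_le i : delta i <= `|v i - F b| by exact: boundary_dist_le.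
have sc_split i j : (i <= j)%N -> sc i * h ^+ (m * (j - i)) = sc j.
  by move=> ij; rewrite /sc -mulrA -exprD -mulnDr subnKC.
have up i j : (i <= j)%N -> relative_distance D (p i) (p j) <= 1 + 4 * C * 2 ^+ (m * (j - i)).
  move=> ij; have [_ bi di] := Hp i; have [_ bj dj] := Hp j.
  have scij : sc j <= sc i by rewrite -(sc_split i j)// ler_piMr ?(ltW (sc0 i))// exprn_ile1// ltW.
  have -> : 4 * C * 2 ^+ (m * (j - i)) = (4 * sc i) / (sc j / C).
    rewrite -(sc_split i j)// exprVn; field.
    by rewrite !gt_eqF ?exprn_gt0//; lra.
  apply: relative_dist_le.
  - by rewrite divr_gt0//; lra.
  - by rewrite ler_pdivrMr ?(le_trans scij)// ?[_ * C]mulrC//; lra.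
  - by rewrite ler_pdivrMr// ?[_ * C]mulrC//; lra.
  - by have := ler_distD b (p i) (p j); rewrite (distrC b); lra.
have near i j : (i <= j)%N -> `|v i - v j| <= a (j - i)%N * Num.min (delta i) (delta j).
  move=> ij; apply: relative_dist_norm => //; apply: le_trans (ctrl_le ctl _ _) _ => //.
  by rewrite lerXn2r ?nnegrE ?up// ?(le_trans ler01)// ?relative_dist_ge1//
    lerDl !mulr_ge0//; lra.
have amono k l : (k <= l)%N -> a k <= a l.
  move=> kl; rewrite lerXn2r ?nnegrE ?addr_ge0 ?mulr_ge0//; try lra.
  by rewrite lerD2l ler_wpM2l ?ler_eXn2l ?ltr1n// ?leq_mul2l ?kl ?orbT//; lra.
have [v0|v0] := leP `|v 0%N - F b| r.
  exists (p 0%N), s0; have [_ b0 d0] := Hp 0%N.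
  rewrite /sc muln0 expr0 mulr1 in b0 d0; split => //; first by rewrite s00 lexx.
  by split => //; left.
have cv e : 0 < e -> exists n, forall i, (n <= i)%N -> `|v i - F b| < e.
  move=> e0; have [eta eta0 He] := ctrl_cont ctl Bb e0.
  have s02 : 0 <= 2 * s0 by lra.
  have [n Hn] := geometric_lt s02 eta0; exists n => i ni; apply: He => //.
  have [_ bi _] := Hp i; apply: (le_lt_trans bi); rewrite /sc mulrA.
  by apply: Hn; rewrite (leq_trans ni)// leq_pmull.
have [n1 Hn1] := cv r r0.
(* [N0] is the last index whose image lies outside the ball of radius [r] around [F b]. *)
have [|N0 N0r N0le] := @last_index (fun i => r < `|v i - F b|) n1 v0.
  by move=> i ni; rewrite -leNgt ltW// Hn1.
have {}N0le i : (N0 < i)%N -> `|v i - F b| <= r by move=> /N0le; rewrite -leNgt.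
have [n2 Hn2] : exists n2, forall i, (n2 <= i)%N -> `|v i - F b| < r / 4 by apply: cv; lra.
pose n := maxn n2 N0.+1.
have Nn : (N0.+1 <= n)%N by rewrite leq_maxr.
have vn : `|v n - F b| < r / 4 by apply: Hn2; rewrite leq_maxl.
have minl i j : Num.min (delta i) (delta j) <= delta i by rewrite ge_min lexx.
have minr i j : Num.min (delta i) (delta j) <= delta j by rewrite ge_min lexx orbT.
have near2 i j k : (i <= j)%N -> (j - i <= k)%N ->
    `|v i - v j| <= a k * delta i /\ `|v i - v j| <= a k * delta j.
  move=> ij jik; have H := near i j ij; have aa := amono _ _ jik.
  by split; apply: (le_trans H); rewrite ler_pM// ?(ltW (min_dist_gt0 hD' _ _)).
have Q0 : 0 <= 6 * C * r by rewrite !mulr_ge0//; lra.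
have [|||i [iN dN vv]] := @turning_point _ _ v delta A (a n0) (6 * C * r) n0 N0.+1 n A0 Q0 Nn.
- by move=> i _; apply: (near2 i i.+1 1%N); rewrite ?subSnn.
- by move=> i j _ /andP[ij _] jn0; apply: (near2 i j n0); rewrite ?leq_subLR.
- move=> i j iN /andP[ij jn].
  have {}vi : `|v i - F b| <= r by exact: N0le.
  have {}vj : `|v j - F b| <= r by apply: N0le; exact: leq_trans ij.
  have [_ bi di] := Hp i; have [_ bj dj] := Hp j.
  pose mn := Num.min (delta i) (delta j).
  have mn0 : 0 < mn by exact: min_dist_gt0.
  have mnr : mn <= r by apply: le_trans (minl i j) _; apply: le_trans (delta_le i) vi.
  suff H : mn <= 6 * C * r * h ^+ (j - i).
    by move: H; rewrite ge_min => /orP.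
  have J' : relative_distance D' (v i) (v j) <= 3 * r / mn.
    apply: (@le_trans _ _ (1 + 2 * r / mn)).
      rewrite lerD2l ler_pM2r ?invr_gt0//.
      by have := ler_distD (F b) (v i) (v j); rewrite (distrC (F b)); lra.
    rewrite -lerBrDr -mulrBl; rewrite ler_pdivlMr//; lra.
  (* The boundary distance is at least [sc i / C] at [p i] and at most [2 * sc j] at [p j]; the
     relative distance is at least their ratio. *)
  have J : 2 ^+ (m * (j - i)) <= 2 * C * relative_distance D (p i) (p j).
    have b1 : boundary_dist D (p j) <= 2 * sc j.
      have [? ? ?] := hD; apply: le_trans bj; exact: boundary_dist_le.
    have rt := relative_dist_ratio hD (Dp i) (Dp j).
    have J1 := relative_dist_ge1 hD (Dp i) (Dp j).
    set J := relative_distance _ _ _ in rt J1 *.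
    have H : sc i * 1 <= sc i * (2 * C * J * h ^+ (m * (j - i))).
      have -> : sc i * (2 * C * J * h ^+ (m * (j - i))) = C * (J * (2 * sc j)).
        by rewrite -(sc_split i j)//; ring.
      rewrite mulr1; apply: (le_trans di); rewrite ler_wpM2l//; first lra.
      by apply: (le_trans rt); rewrite ler_wpM2l//; lra.
    by move: H; rewrite ler_pM2l// exprVn ler_pdivlMr ?exprn_gt0// mul1r.
  have J1' := relative_dist_ge1 hD' (D'v i) (D'v j).
  have J2 : 2 ^+ (j - i) <= 6 * C * r / mn.
    have X0 : 0 <= 6 * C * r / mn by rewrite divr_ge0// ltW.
    rewrite -(@ler_pXn2r _ m)// ?nnegrE ?exprn_ge0// -exprM mulnC.
    apply: (le_trans J); have -> : 6 * C * r / mn = (2 * C) * (3 * r / mn) by ring.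
    rewrite exprMn ler_pM//; first by lra.
    - by apply: le_trans (relative_dist_ge1 hD (Dp i) (Dp j)).
    - by rewrite ler_eXnr//; lra.
    - apply: le_trans (ctrl_ge ctl (Dp i) (Dp j)) _.
      by rewrite lerXn2r ?nnegrE ?(le_trans ler01 J1')// (le_trans _ J')// (le_trans ler01).
  by rewrite exprVn ler_pdivlMr ?exprn_gt0// mulrC -ler_pdivlMr.
exists (p i), (sc i); have [_ bi di] := Hp i; split => //; first by rewrite sc0 sc_le.
split; first by apply: N0le; case/andP: iN.
(* Go from [v N0], outside the ball, to [F b] through [v N0.+1] and [v n]. The pieces cost at most
   [A * delta i], then [2 * a n0 * delta i + r / 4], then [r / 4], which leaves [r / 2] below
   [(A + 2 * a n0) * delta i]. *)
right; have [||_ st] := near2 N0 N0.+1 1%N; rewrite ?subSnn//.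
have := ler_distD (v N0.+1) (v N0) (F b); have := ler_distD (v n) (v N0.+1) (F b).
have : A * delta N0.+1 <= A * delta i by rewrite ler_wpM2l.
have : 4 * A * (6 * C * r) * h ^+ n0 <= r / 4.
  have -> : 4 * A * (6 * C * r) * h ^+ n0 = (96 * A * C * h ^+ n0) * (r / 4) by field.
  by rewrite ler_piMl//; lra.
rewrite -/A in st; have := delta0 i; rewrite -/(delta i).
lra.
Qed.

End boundary_control.

(** * Lipschitz estimate *)

Section lipschitz.
Context {R : realType}.

(** As [F b] is a boundary point, [F p] has boundary distance at most [r], and the relative distance
    of [F x] and [F p] is bounded. *)
Lemma image_dist_le {E E' : normedModType R} (C L rho : R) (m : nat)
    (D : set E) (D' : set E') (F : E -> E') (x p b : E) (e r : R) :
  controlled C L rho m D D' F -> D x -> D p -> finite_boundary D b ->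
  0 < e -> e <= boundary_dist D x -> e <= boundary_dist D p ->
  `|x - p| <= 4 * boundary_dist D x -> `|F p - F b| <= r ->
  `|F x - F b| <= ((1 + 4 * boundary_dist D x / e) ^+ m + 1) * r.
Proof.
move=> ctl Dx Dp Bb e0 ex ep xp fp; set k := _ ^+ m.
have hD := ctrl_dom ctl; have hD' := ctrl_cod ctl; have [D0' oD' DT'] := hD'.
have Jx := relative_dist_le e0 ex ep xp.
have Fx := ctrl_map ctl Dx; have Fp := ctrl_map ctl Dp.
have JF : relative_distance D' (F x) (F p) <= k.
  apply: le_trans (ctrl_le ctl Dx Dp) _.
  by rewrite lerXn2r ?nnegrE// ?(le_trans _ Jx)// (le_trans ler01)// relative_dist_ge1.
have k0 : 0 <= k := le_trans ler01 (le_trans (relative_dist_ge1 hD' Fx Fp) JF).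
have N := relative_dist_norm hD' Fx Fp JF.
have mr : Num.min (boundary_dist D' (F x)) (boundary_dist D' (F p)) <= r.
  rewrite ge_min; apply/orP; right; apply: le_trans _ fp.
  by apply: boundary_dist_le => //; exact: (ctrl_bdry ctl).
have := ler_wpM2l k0 mr; have := ler_distD (F p) (F x) (F b); lra.
Qed.

(* Two deep image points are close to each other relative to their depth, hence
   so are their preimages, which therefore cannot lie much closer to b1 than b2
   does. *)
Lemma deep_points_separation {E E' : normedModType R} (C L rho C2 : R) (m : nat)
    (D : set E) (D' : set E') (F : E -> E') (b1 b2 p1 p2 : E) (s1 s2 r : R) :
  1 <= C -> 1 <= C2 -> 0 < r -> controlled C L rho m D D' F -> D p1 -> D p2 ->
  finite_boundary D b1 -> `|p1 - b1| <= 2 * s1 -> `|p2 - b2| <= 2 * s2 ->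
  s2 <= C * boundary_dist D p2 ->
  `|F p1 - F b1| <= r -> `|F p2 - F b2| <= r -> `|F b1 - F b2| <= r ->
  r <= C2 * boundary_dist D' (F p1) -> r <= C2 * boundary_dist D' (F p2) ->
  `|b1 - b2| <= (2 + 2 * (1 + 3 * C2) ^+ m + 4 * C * (1 + (1 + 3 * C2) ^+ m)) * s1.
Proof.
move=> C1 C21 r0 ctl Dp1 Dp2 B1 pb1 pb2 sd2 fp1 fp2 rr alt1 alt2.
have hD := ctrl_dom ctl; have hD' := ctrl_cod ctl; have [D0 oD DT] := hD.
have Fp1 := ctrl_map ctl Dp1; have Fp2 := ctrl_map ctl Dp2.
have C20 : 0 < C2 by lra.
have JF : relative_distance D' (F p1) (F p2) <= 1 + 3 * C2.
  have -> : 3 * C2 = 3 * r / (r / C2) by field; rewrite !gt_eqF.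
  apply: relative_dist_le; first exact: divr_gt0.
  - by rewrite ler_pdivrMr// [_ * C2]mulrC.
  - by rewrite ler_pdivrMr// [_ * C2]mulrC.
  - have := ler_distD (F b1) (F p1) (F p2); have := ler_distD (F b2) (F b1) (F p2).
    rewrite (distrC (F b2) (F p2)); lra.
set C5 : R := (1 + 3 * C2) ^+ m.
have J5 : relative_distance D p1 p2 <= C5.
  apply: le_trans (ctrl_ge ctl Dp1 Dp2) _.
  rewrite lerXn2r ?nnegrE ?(le_trans ler01 (relative_dist_ge1 hD' Fp1 Fp2))//; lra.
have C50 : 0 <= C5 := le_trans ler01 (le_trans (relative_dist_ge1 hD Dp1 Dp2) J5).
have d1 : boundary_dist D p1 <= 2 * s1.
  by apply: le_trans pb1; exact: boundary_dist_le.
have N5 : `|p1 - p2| <= C5 * (2 * s1).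
  apply: (le_trans (relative_dist_norm hD Dp1 Dp2 J5)).
  by rewrite ler_wpM2l// ge_min d1.
have d2 : boundary_dist D p2 <= (1 + C5) * (2 * s1).
  have := boundary_dist_lip oD D0 DT p2 p1; rewrite distrC; lra.
have C0 : 0 <= C by lra.
have s2s1 := le_trans sd2 (ler_wpM2l C0 d2).
have := ler_distD p1 b1 b2; have := ler_distD p2 p1 b2; rewrite (distrC b1 p1); lra.
Qed.

(** Descend to both [b1] and [b2]. If one of the points found has the initial scale [t / 4], it is
    comparable with [x] and near the right boundary image. Otherwise both images are deep, and
    separation of [b1] and [b2] forces the scale at [b1] to be comparable with [t]. *)
Lemma boundary_image_near (C L rho : R) (m : nat) :
  1 <= C -> 1 <= L -> 0 < rho -> (0 < m)%N ->
  exists2 K : R, 1 <= K & forall (E E' : normedModType R)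
    (D : set E) (D' : set E') (F : E -> E') x,
  controlled C L rho m D D' F -> D x ->
  exists b, [/\ finite_boundary D b, `|x - b| <= 2 * boundary_dist D x &
    `|F x - F b| <= K * boundary_dist D x].
Proof.
move=> C1 L1 rho0 m0; have [C2 C21 deep] := deep_image_point C1 m0.
pose C5 : R := (1 + 3 * C2) ^+ m; pose C6 : R := 2 + 2 * C5 + 4 * C * (1 + C5).
have C0 : 0 < C by lra.
have L0 : 0 < L by lra.
have C50 : 0 <= C5 by rewrite exprn_ge0//; lra.
have C61 : 1 <= C6.
  have : 0 <= 4 * C * (1 + C5) by rewrite !mulr_ge0//; lra.
  rewrite /C6; lra.
have CC6 : 0 < C * C6 by rewrite mulr_gt0//; lra.
(* The factors of [image_dist_le] for points of boundary distance at least [t / (4 * C)] and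
   [rho * t / (C * C6)], where [t] is that of [x]. *)
pose K1 : R := (1 + 16 * C) ^+ m; pose K2 : R := (1 + 4 * (C * C6) / rho) ^+ m.
have K10 : 0 <= K1 by rewrite exprn_ge0//; lra.
have K20 : 0 <= K2.
  by rewrite exprn_ge0// addr_ge0// divr_ge0 ?(ltW rho0)//; lra.
have K3 : 1 <= 2 + K1 + K2 by lra.
exists ((2 + K1 + K2) * L); first by rewrite -[leLHS]mulr1 ler_pM.
move=> E E' D D' F x ctl Dx; have hD := ctrl_dom ctl; have [D0 oD DT] := hD.
have [b1 [b2 [B1 B2 xb1 rb br]]] := ctrl_spread ctl Dx.
exists b1; split=> //; have t0 := dist_gt0 hD Dx; rewrite -mulrA.
have r0 := mulr_gt0 L0 t0.
have rr : `|F b1 - F b2| <= L * boundary_dist D x.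
  by apply: (le_trans (ctrl_lip ctl B1 B2)); rewrite ler_wpM2l// ltW.
set t := boundary_dist D x in xb1 rb br t0 rr r0 *.
set r := L * t in r0 rr *.
have tb b : finite_boundary D b -> 4 * (t / 4) <= `|x - b|.
  by move=> Bb; rewrite mulrCA divff ?mulr1 ?boundary_dist_le// lt0r_neq0.
have t40 : 0 < t / 4 by rewrite divr_gt0.
have xb2 : `|x - b2| <= 3 * t by have := ler_distD b1 x b2; lra.
have start (b p : E) : finite_boundary D b -> `|x - b| <= 3 * t -> D p ->
    `|p - b| <= 2 * (t / 4) -> t / 4 <= C * boundary_dist D p ->
    `|F p - F b| <= r -> `|F x - F b| <= (K1 + 1) * r.
  move=> Bb xb Dp pb sd fp.
  have -> : K1 = (1 + 4 * t / (t / 4 / C)) ^+ m.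
    by rewrite /K1; congr ((1 + _) ^+ m); field; rewrite !gt_eqF.
  apply: image_dist_le ctl Dx Dp Bb _ _ _ _ fp; rewrite -/t.
  - by rewrite divr_gt0.
  - by rewrite ler_pdivrMr// -[leLHS]mulr1 ler_pM//; lra.
  - by rewrite ler_pdivrMr// [_ * C]mulrC.
  - by have := ler_distD b x p; rewrite (distrC b); lra.
have K1r : 0 <= K1 * r by rewrite mulr_ge0// ltW.
have K2r : 0 <= K2 * r by rewrite mulr_ge0// ltW.
have [p1 [s1 [Dp1 /andP[s10 s1t] pb1 sd1 [fp1 alt1]]]] :=
  deep _ _ _ _ _ _ _ _ _ _ _ ctl B1 Dx t40 (tb _ B1) r0.
have [p2 [s2 [Dp2 /andP[s20 s2t] pb2 sd2 [fp2 alt2]]]] :=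
  deep _ _ _ _ _ _ _ _ _ _ _ ctl B2 Dx t40 (tb _ B2) r0.
have [E1|alt1'] := eqVneq s1 (t / 4).
  rewrite E1 in pb1 sd1; have xb1' : `|x - b1| <= 3 * t by lra.
  by have := start _ _ B1 xb1' Dp1 pb1 sd1 fp1; lra.
have {alt1 alt1'} alt1 : r <= C2 * boundary_dist D' (F p1).
  by case: alt1 alt1' => // ->; rewrite eqxx.
have [E2|alt2'] := eqVneq s2 (t / 4).
  rewrite E2 in pb2 sd2; have := start _ _ B2 xb2 Dp2 pb2 sd2 fp2.
  by have := ler_distD (F b2) (F x) (F b1); rewrite (distrC (F b2)); lra.
have {alt2 alt2'} alt2 : r <= C2 * boundary_dist D' (F p2).
  by case: alt2 alt2' => // ->; rewrite eqxx.
have ts1 : rho * t <= C6 * s1.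
  apply: (le_trans rb).
  exact: (deep_points_separation C1 C21 r0 ctl Dp1 Dp2 B1 pb1 pb2 sd2 fp1 fp2 rr alt1 alt2).
suff : `|F x - F b1| <= (K2 + 1) * r by lra.
have -> : K2 = (1 + 4 * t / (rho * t / (C * C6))) ^+ m.
  by rewrite /K2; congr ((1 + _) ^+ m); field; rewrite !gt_eqF//; lra.
have rho1 : rho <= 1 by rewrite -(ler_pM2r t0) mul1r; apply: le_trans br.
apply: image_dist_le ctl Dx Dp1 B1 _ _ _ _ fp1; rewrite -/t.
- by rewrite divr_gt0// mulr_gt0.
- rewrite ler_pdivrMr// mulrC ler_wpM2l ?(ltW t0)// (le_trans rho1)//.
  by rewrite -[leLHS]mulr1 ler_pM.
- rewrite ler_pdivrMr//; apply: (le_trans ts1).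
  have -> : boundary_dist D p1 * (C * C6) = C6 * (C * boundary_dist D p1) by ring.
  by rewrite ler_wpM2l//; lra.
- by have := ler_distD b1 x p1; rewrite (distrC b1); lra.
Qed.

(** The right side is the chord over [0, 1] of a convex function. *)
Lemma expr_linear_le (u : R) m : 0 <= u <= 1 -> (1 + u) ^+ m <= 1 + (2 ^+ m - 1) * u.
Proof.
move=> /andP[u0 u1]; elim: m => [|m IH]; first by rewrite !expr0; lra.
rewrite !exprS; have : (1 + u) * (1 + u) ^+ m <= (1 + u) * (1 + (2 ^+ m - 1) * u).
  by rewrite ler_wpM2l//; lra.
move=> H; apply: (le_trans H).
have : 1 <= 2 ^+ m :> R by rewrite exprn_ege1// ler1n.
set a : R := 2 ^+ m => a1; have : 0 <= (a - 1) * (u * (1 - u)).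
  by rewrite !mulr_ge0//; lra.
nra.
Qed.

Lemma controlled_lipschitz (C L rho : R) (m : nat) :
  1 <= C -> 1 <= L -> 0 < rho -> (0 < m)%N ->
  exists2 Lam : R, 1 <= Lam & forall (E E' : normedModType R)
    (D : set E) (D' : set E') (F : E -> E') x y,
  controlled C L rho m D D' F -> D x -> D y -> `|F x - F y| <= Lam * `|x - y|.
Proof.
move=> C1 L1 rho0 m0; have [K K1 near] := boundary_image_near C1 L1 rho0 m0.
have P0 : 1 <= 2 ^+ m :> R by rewrite exprn_ege1// ler1n.
have PK : 1 <= 2 ^+ m * K by rewrite -[leLHS]mulr1 ler_pM.
(* The first term serves close points, where the relative distance is nearly 1. For far points, with
   [r] their distance, the boundary distances are at most [2 * r] and [3 * r], and the chosen
   boundary points are at most [11 * r] apart. *)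
exists (2 * 2 ^+ m * K + 5 * K + 11 * L); first lra.
move=> E E' D D' F x y ctl Dx Dy.
have hD := ctrl_dom ctl; have hD' := ctrl_cod ctl.
have [D0 oD DT] := hD; have [D0' oD' DT'] := hD'.
have [bx [Bx xbx Fbx]] := near _ _ _ _ _ _ ctl Dx.
have [by_ [By yby Fby]] := near _ _ _ _ _ _ ctl Dy.
have Fx := ctrl_map ctl Dx; have Fy := ctrl_map ctl Dy.
have dx := dist_gt0 hD Dx; have dy := dist_gt0 hD Dy.
have lxy := boundary_dist_lip oD D0 DT x y.
have lyx := boundary_dist_lip oD D0 DT y x; rewrite distrC in lyx.
set r := `|x - y| in lxy lyx *.
have r0 : 0 <= r by exact: normr_ge0.
have Lr : 0 <= L * r by rewrite mulr_ge0//; lra.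
have Kr : 0 <= K * r by rewrite mulr_ge0//; lra.
have PKr : 0 <= 2 ^+ m * K * r by rewrite mulr_ge0//; lra.
have [near_xy|far] := leP r (boundary_dist D x / 2).
  pose u := r / (boundary_dist D x / 2).
  have u01 : 0 <= u <= 1.
    by rewrite divr_ge0 ?ler_pdivrMr ?mul1r//; lra.
  have Ju : relative_distance D x y <= 1 + u.
    by apply: relative_dist_le => //; lra.
  have JF : relative_distance D' (F x) (F y) <= 1 + (2 ^+ m - 1) * u.
    apply: le_trans (ctrl_le ctl Dx Dy) (le_trans _ (expr_linear_le m u01)).
    rewrite lerXn2r ?nnegrE// ?(le_trans ler01 (relative_dist_ge1 hD Dx Dy))//.
    by apply: le_trans Ju; exact: (le_trans ler01 (relative_dist_ge1 hD Dx Dy)).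
  have dFx : boundary_dist D' (F x) <= K * boundary_dist D x.
    apply: le_trans _ Fbx; apply: boundary_dist_le => //; exact: (ctrl_bdry ctl).
  move: JF; rewrite lerD2l ler_pdivrMr ?min_dist_gt0// => JF.
  have mK : Num.min (boundary_dist D' (F x)) (boundary_dist D' (F y)) <= K * boundary_dist D x.
    by rewrite ge_min dFx.
  have c0 : 0 <= (2 ^+ m - 1) * u by rewrite mulr_ge0//; lra.
  have {}JF := le_trans JF (ler_wpM2l c0 mK).
  have E1 : u * boundary_dist D x = 2 * r.
    by rewrite /u; field; rewrite !gt_eqF.
  have : (2 ^+ m - 1) * u * (K * boundary_dist D x) = 2 * (2 ^+ m) * K * r - 2 * (K * r).
    have -> : (2 ^+ m - 1) * u * (K * boundary_dist D x) =
      (2 ^+ m - 1) * K * (u * boundary_dist D x) by ring.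
    by rewrite E1; ring.
  lra.
have := ler_distD (F bx) (F x) (F y); have := ler_distD (F by_) (F bx) (F y).
have := ctrl_lip ctl Bx By; rewrite (distrC (F by_) (F y)).
have : L * `|bx - by_| <= L * (11 * r).
  rewrite ler_wpM2l//; first lra.
  have := ler_distD x bx by_; have := ler_distD y x by_; rewrite (distrC bx x).
  rewrite -/r; lra.
have : K * boundary_dist D x <= K * (2 * r) by rewrite ler_wpM2l//; lra.
have : K * boundary_dist D y <= K * (3 * r) by rewrite ler_wpM2l//; lra.
lra.
Qed.

End lipschitz.

(** * Boundary points at prescribed scales *)

Section boundary_scales.
Context {R : realType} {E : normedModType R}.
Implicit Type D : set E.

(** Under an [L]-bilipschitz map only [rho] worsens, by the factor [L ^+ 2], whereas the constant
    [r2 < 1] of the HD condition could grow beyond 1. *)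
Definition scale_dense (rho : R) D : Prop := forall a b r,
  finite_boundary D a -> finite_boundary D b -> 0 < r -> r <= `|a - b| ->
  exists2 x, finite_boundary D x & rho * r <= `|x - b| <= r.

(** Iterate the HD condition from [a] towards [b]. A step cannot jump over the window from [r1 * r]
    to [r], so if the window were empty all distances would stay at least [r], although they decay
    like [r2 ^+ n]. *)
Lemma boundary_HD_scale_dense (r1 r2 : R) D : 0 < r1 -> r1 <= r2 -> r2 < 1 ->
  open D -> boundary_HD r1 r2 D -> scale_dense r1 D.
Proof.
move=> r10 r12 r21 oD [HD _] a b r Ba Bb r0 rab; apply: contrapT => none.
have big x : finite_boundary D x -> r1 * r <= `|x - b| -> r < `|x - b|.
  move=> Bx xr; rewrite ltNge; apply/negP => xr'; apply: none.
  by exists x => //; rewrite xr.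
have iter n : exists x, [/\ finite_boundary D x, r <= `|x - b| &
    `|x - b| <= r2 ^+ n * `|a - b|].
  elim: n => [|n [x [Bx rx xn]]]; first by exists a; rewrite expr0 mul1r.
  have [//|//|y [/ext_boundary_fin By y1 y2]] := HD b x; try exact/ext_boundary_fin.
  have {}By := By oD; exists y; split => //.
    apply/ltW/big => //; apply: le_trans y1; rewrite ler_wpM2l// ltW//.
  by apply: (le_trans y2); rewrite exprS -mulrA ler_wpM2l//; lra.
have r20 : 0 < r2 by lra.
have [n Hn] : exists n, r2 ^+ n * `|a - b| < r.
  have ab0 : 0 < `|a - b| by lra.
  have : r2 ^+ n @[n --> \oo] --> (0 : R) by apply: cvg_expr; rewrite gtr0_norm.
  have rab0 : 0 < r / `|a - b| by rewrite divr_gt0.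
  move=> /cvgrPdist_lt/(_ _ rab0)[n _ /(_ n (leqnn n))].
  by rewrite sub0r normrN gtr0_norm ?exprn_gt0// ltr_pdivlMr//; exists n.
by have [x [_ rx xn]] := iter n; lra.
Qed.

(** Follow the ray from [x] pointing away from [b]: it leaves [D] through a boundary point, or it
    stays in [D] and goes to infinity. *)
Lemma ray_alternative D (x b : E) : open D -> D x -> finite_boundary D b ->
  (exists2 a, finite_boundary D a & `|x - b| <= `|a - b|) \/
  ext_closure D (infty_pt E).
Proof.
move=> oD Dx [_ nDb].
have xb0 : 0 < `|x - b|.
  by rewrite normr_gt0 subr_eq0; apply: contra_notN nDb => /eqP <-.
have addKx (v : E) : x + v - x = v by rewrite addrC addKr.
have [[s s0 nDs]|none] := pselect (exists2 s : R, 0 <= s & ~ D (x + s *: (x - b))).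
  left; have [u [/andP[u0 _]]] := segment_boundary oD Dx nDs.
  rewrite addKx scalerA => Ba; exists (x + (u * s) *: (x - b)) => //.
  rewrite addrAC -{2}[x - b]scale1r -scalerDl normrZ ger0_norm.
    by rewrite ler_peMl// lerDl mulr_ge0.
  by rewrite addr_ge0// mulr_ge0.
right=> V [C [_ [M [_ bC]]] CV].
have {}bC z : C z -> `|z| <= `|M| + 1.
  by apply: bC; rewrite (le_lt_trans (ler_norm M))// ltrDl.
pose s := (`|M| + 2 + `|x|) / `|x - b|.
have s0 : 0 <= s by rewrite divr_ge0// !addr_ge0.
exists (fin_pt (x + s *: (x - b))); split.
  by eexists; [|reflexivity]; apply: contrapT => nD; apply: none; exists s.
apply: CV => -[z Cz [zE]]; have := bC z Cz; rewrite zE.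
have := ler_normB (x + s *: (x - b)) x; rewrite addKx normrZ (ger0_norm s0) /s mulfVK ?gt_eqF// => H1 H2.
by have := le_trans H1 (lerD H2 (lexx _)); lra.
Qed.

(** Otherwise the complement of a closed ball would be a neighbourhood of infinity that meets the
    boundary in infinity alone. *)
Lemma unbounded_boundary D (b : E) (r : R) : open D ->
  isolated (ext_boundary D) = set0 -> ext_closure D (infty_pt E) ->
  exists2 a, finite_boundary D a & r <= `|a - b|.
Proof.
move=> oD iso cD; apply: contrapT => none.
suff : isolated (ext_boundary D) (infty_pt E) by rewrite iso.
have Binf : ext_boundary D (infty_pt E).
  by split => // H; have [z _] := nbhs_singleton H.
split; first exact/mem_set.
pose C := closed_ball_ Num.Def.normr b r.
exists (~` (@fin_pt R E @` C)).
  exists C => //; split; first exact: closed_closed_ball_.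
  exists (`|b| + r); split; first exact: num_real.
  move=> M bM z; rewrite /C/closed_ball_/= => bz.
  by have := ler_distD b z 0; rewrite !subr0 distrC; lra.
apply/seteqP; split => [[z|] [nC Bz]|_ ->]; last by split => // -[].
- exfalso; apply: nC; exists z => //; rewrite /C/closed_ball_/= leNgt distrC.
  apply/negP => rz; apply: none; exists z; last exact: ltW.
  exact/ext_boundary_fin.
- by [].
Qed.

Lemma scale_dense_spread (rho : R) D : proper_open D -> scale_dense rho D ->
  (forall x b, D x -> finite_boundary D b ->
    exists2 a, finite_boundary D a & boundary_dist D x <= `|a - b|) ->
  boundary_spread rho D.
Proof.
move=> hD sd far x Dx; have [D0 oD DT] := hD.
have [b Bb xb] := boundary_dist_attained oD D0 DT Dx.
have [a Ba ab] := far _ _ Dx Bb.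
have [y By /andP[y1 y2]] := sd _ _ _ Ba Bb (dist_gt0 hD Dx) ab.
by exists b, y; rewrite (distrC b); split.
Qed.

End boundary_scales.

(** * Passage to the closure and the bilipschitz bound *)

Section assembly.
Context {R : realType}.

(* The value at infinity is junk. *)
Definition fin_val {E : normedModType R} (p : infty_extension E) : E :=
  if p is Some x then x else 0.

Lemma ext_closure_sub {E : normedModType R} (D : set E) x :
  D x -> ext_closure D (fin_pt x).
Proof. by move=> Dx; apply/ext_closure_fin; exact: subset_closure. Qed.

Lemma ext_closure_boundary {E : normedModType R} (D : set E) b :
  finite_boundary D b -> ext_closure D (fin_pt b).
Proof. by case=> Db _; apply/ext_closure_fin. Qed.

Lemma uniform_domain_mono {E : normedModType R} (c c' : R) (D : set E) : c <= c' ->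
  proper_open D -> uniform_domain c D -> uniform_domain c' D.
Proof.
move=> cc' hD u x y Dx Dy; have [al [a [b [j cig l]]]] := u x y Dx Dy.
exists al, a, b; split => //.
- move=> t tab; apply: (le_trans (cig t tab)); rewrite lee_fin ler_wpM2r//.
  by apply: ltW; apply: (dist_gt0 hD); case: j => _ aD _ _; apply: aD; exists t.
- by apply: (le_trans l); rewrite lee_fin ler_wpM2r.
Qed.

Lemma finite_continuity {E E' : normedModType R} (A : set (infty_extension E))
    (f : infty_extension E -> infty_extension E') (b : E) (b' : E') (e : R) :
  {within A, continuous f} -> A (fin_pt b) -> f (fin_pt b) = fin_pt b' -> 0 < e ->
  exists2 eta, 0 < eta & forall z z', A (fin_pt z) -> `|z - b| < eta ->
    f (fin_pt z) = fin_pt z' -> `|z' - b'| < e.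
Proof.
move=> cf Ab fb e0; have /subspace_continuousP/(_ _ Ab) := cf.
rewrite /from_subspace fb => /(_ (@fin_pt R E' @` ball b' e)) H.
have {H} : nbhs b [set z | A (fin_pt z) -> (@fin_pt R E' @` ball b' e) (f (fin_pt z))].
  apply: H; rewrite nbhs_fin_pt; apply: filterS (nbhsx_ballx b' e e0) => z bz.
  by exists z.
move=> /nbhs_ballP[eta /= eta0 H]; exists eta => // z z' Az zb fz.
have [|w bw] := H z _ Az; first by rewrite -ball_normE/= distrC.
rewrite fz => -[wz]; move: bw; rewrite wz -ball_normE/= distrC; exact.
Qed.

(** Two maps [G] and [H] are compared so that the upper bound ([F] against the identity) and the
    lower bound (the identity against [F]) are both instances. *)
Lemma lipschitz_closure {E X Y : normedModType R} (Lam : R) (D : set E)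
    (G : E -> X) (H : E -> Y) : 0 <= Lam ->
  (forall x e, closure D x -> 0 < e ->
     exists z, [/\ D z, `|G z - G x| < e & `|H z - H x| < e]) ->
  (forall x y, D x -> D y -> `|G x - G y| <= Lam * `|H x - H y|) ->
  forall x y, closure D x -> closure D y -> `|G x - G y| <= Lam * `|H x - H y|.
Proof.
move=> L0 app lip x y cx cy; apply/ler_addgt0Pr => e e0.
pose h := e / (2 * Lam + 2); have h0 : 0 < h by rewrite divr_gt0//; lra.
have [x1 [Dx1 Gx1 Hx1]] := app _ _ cx h0; have [y1 [Dy1 Gy1 Hy1]] := app _ _ cy h0.
have eE : e = 2 * (Lam * h) + 2 * h by rewrite /h; field; rewrite gt_eqF//; lra.
have := lip _ _ Dx1 Dy1.
have : Lam * `|H x1 - H y1| <= Lam * (`|H x - H y| + 2 * h).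
  rewrite ler_wpM2l//.
  have := ler_distD (H x) (H x1) (H y1); have := ler_distD (H y) (H x) (H y1).
  rewrite (distrC (H y) (H y1)); lra.
have := ler_distD (G x1) (G x) (G y); have := ler_distD (G y1) (G x1) (G y).
rewrite (distrC (G x) (G x1)); lra.
Qed.

End assembly.

Unset Implicit Arguments.

Theorem theorem1p4 (R : realType) (c r1 r2 L M : R)
  (hr1 : 0 < r1) (hr12 : r1 <= r2) (hr2 : r2 < 1) (hL : 1 <= L) (hM : 1 <= M) :
  exists2 M' : R, 1 <= M' &
  forall (E E' : completeNormedModType R) (D : set E) (D' : set E')
    (f : infty_extension E -> infty_extension E') (f0 : E -> E'),
    dim_ge2 E -> dim_ge2 E' ->
    domain D -> D <> setT -> domain D' -> D' <> setT ->
    uniform_domain c D -> uniform_domain c D' ->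
    boundary_HD r1 r2 D ->
    homeo_between (ext_closure D) (ext_closure D') f ->
    (forall x, D x -> f (fin_pt x) = fin_pt (f0 x)) ->
    FQC (fun t => M * t) D D' f0 ->
    boundary_bilipschitz L D D' f ->
    bilipschitz_on M' (ext_closure D) f.
Proof.
  pose C := Num.max c 1.
  have C1 : 1 <= C by rewrite le_max lexx orbT.
  have cC : c <= C by rewrite le_max lexx.
  pose n := (Num.truncn C).+1.
  have Cn : C <= n%:R by exact/ltW/truncnS_gt.
  pose m := (Num.truncn (6 * M * C * n%:R)).+1.
  have Mm : 6 * M * C * n%:R <= m%:R by exact/ltW/truncnS_gt.
  have M0 : 0 <= M by lra.
  have L0 : 0 < L by lra.
  (* A scale [r] at the boundary of [D'] is sought as [r / L] at that of [D]; going back by [f]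
     costs a second factor [L] in the lower bound. *)
  pose rho := r1 / L ^+ 2.
  have rho0 : 0 < rho by rewrite divr_gt0// exprn_gt0.
  have [Lam1 Lam1_1 lip1] := controlled_lipschitz C1 hL hr1 (ltn0Sn _ : (0 < m)%N).
  have [Lam2 Lam2_1 lip2] := controlled_lipschitz C1 hL rho0 (ltn0Sn _ : (0 < m)%N).
  exists (Lam1 + Lam2); first lra.
  move=> E E' D D' f f0 _ _ domD DT domD' DT' uD uD' HD [g [fcl gcl [gf fg] cf cg]] ff0.
  move=> [_ [g0 [f0D g0D' [_ f0g0] _ _]] sol] [bim bil].
  have [D0 oD _] := domD; have [D0' oD' _] := domD'.
  have hD : proper_open D by [].
  have hD' : proper_open D' by [].
  have {}uD := uniform_domain_mono cC hD uD.
  have {}uD' := uniform_domain_mono cC hD' uD'.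
  have imD : f0 @` D = D'.
    apply/seteqP; split=> // y D'y; exists (g0 y); last exact: f0g0.
    by apply: g0D'; exists y.
  have [g1 [[_ g1D' [g1f0 f0g1] _ _] k1 k2]] := sol D domD (@subset_refl _ _).
  rewrite imD in k1 k2 g1D' f0g1.
  pose F x := fin_val (f (fin_pt x)); pose G y := fin_val (g (fin_pt y)).
  have FD x : D x -> F x = f0 x by move=> Dx; rewrite /F ff0.
  have fD x : D x -> f (fin_pt x) = fin_pt (F x) by move=> Dx; rewrite /F ff0.
  have f0D' x : D x -> D' (f0 x) by move=> Dx; apply: f0D; exists x.
  have fB b : finite_boundary D b ->
      f (fin_pt b) = fin_pt (F b) /\ finite_boundary D' (F b).
    move=> Bb; have Eb := (ext_boundary_fin b oD).2 Bb.
    have [b' [_ [fb _ _ _]]] := bil b b Eb Eb.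
    have Fb : F b = b' by rewrite /F fb.
    rewrite Fb; split => //; apply/(ext_boundary_fin b' oD').
    suff : (ext_boundary D' `&` range (@fin_pt R E')) (fin_pt b') by case.
    by rewrite -bim; exists (fin_pt b) => //; split => //; exists b.
  have g1D y : D' y -> D (g1 y) by move=> D'y; apply: g1D'; exists y.
  have gD y : D' y -> g (fin_pt y) = fin_pt (g1 y).
    by move=> D'y; rewrite -{1}(f0g1 y D'y) -ff0 ?gf//; [exact/ext_closure_sub/g1D|exact: g1D].
  have GD y : D' y -> G y = g1 y by move=> D'y; rewrite /G gD.
  have FG y : D' y -> F (G y) = y.
    by move=> D'y; rewrite GD// FD ?f0g1//; exact: g1D.
  have GF x : D x -> G (F x) = x.
    by move=> Dx; rewrite FD// GD ?g1f0//; exact: f0D'.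
  have gB y : finite_boundary D' y -> [/\ g (fin_pt y) = fin_pt (G y),
      finite_boundary D (G y) & F (G y) = y].
    move=> By; have : (ext_boundary D' `&` range (@fin_pt R E')) (fin_pt y).
      by split; [exact/ext_boundary_fin|exists y].
    rewrite -bim => -[p [Eb [b _ pb]] fb]; rewrite -pb in Eb fb.
    have Bb := (ext_boundary_fin b oD).1 Eb.
    have gy : g (fin_pt y) = fin_pt b by rewrite -fb gf//; exact: ext_closure_boundary.
    by rewrite /G gy; split => //=; rewrite /F fb.
  have GFB b : finite_boundary D b -> G (F b) = b.
    by move=> Bb; have [fb _] := fB b Bb; rewrite /G -fb gf//; exact: ext_closure_boundary.
  have lipF a b : finite_boundary D a -> finite_boundary D b ->
      `|a - b| / L <= `|F a - F b| <= L * `|a - b|.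
    move=> Ba Bb; have [a' [b' [fa fb ab1 ab2]]] :=
      bil a b ((ext_boundary_fin a oD).2 Ba) ((ext_boundary_fin b oD).2 Bb).
    by rewrite /F fa fb /= ab1.
  have lipG a b : finite_boundary D' a -> finite_boundary D' b ->
      `|G a - G b| <= L * `|a - b|.
    move=> Ba Bb; have [_ Ga Fa] := gB a Ba; have [_ Gb Fb] := gB b Bb.
    have /andP[+ _] := lipF _ _ Ga Gb.
    by rewrite Fa Fb ler_pdivrMr// mulrC.
  have iso : isolated (ext_boundary D) = set0 by case: HD.
  have sdD := boundary_HD_scale_dense hr1 hr12 hr2 oD HD.
  have spD : boundary_spread r1 D.
    apply: scale_dense_spread => // x b Dx Bb.
    have [[a Ba ab]|inf_D] := ray_alternative oD Dx Bb.
      by exists a => //; apply: le_trans ab; exact: boundary_dist_le.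
    exact: unbounded_boundary.
  have sdD' : scale_dense rho D'.
    move=> a b r Ba Bb r0 rab; have [_ Ga Fa] := gB a Ba; have [_ Gb Fb] := gB b Bb.
    have rL : r / L <= `|G a - G b|.
      rewrite ler_pdivrMr//; have /andP[_] := lipF _ _ Ga Gb.
      by rewrite Fa Fb mulrC; exact: le_trans.
    have [|x Bx /andP[x1 x2]] := sdD _ _ _ Ga Gb _ rL; first by rewrite divr_gt0.
    exists (F x); first by have [] := fB x Bx.
    have /andP[l1 l2] := lipF _ _ Bx Gb; rewrite Fb in l1 l2.
    apply/andP; split.
      apply: le_trans l1; rewrite ler_pdivlMr//; apply: le_trans x1.
      by rewrite /rho le_eqVlt; apply/orP; left; apply/eqP; field; rewrite gt_eqF.
    apply: (le_trans l2); apply: (@le_trans _ _ (L * (r / L))).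
      by rewrite ler_wpM2l// ltW.
    by rewrite mulrC divfK// gt_eqF.
  have spD' : boundary_spread rho D'.
    apply: scale_dense_spread => // y b D'y Bb.
    have [[a Ba ab]|inf_D'] := ray_alternative oD' D'y Bb.
      by exists a => //; apply: le_trans ab; exact: boundary_dist_le.
    (* If [g] sent infinity to a finite point, [f] would send that point to infinity, but [f] keeps
       finite points of the closure finite. *)
    have inf_D : ext_closure D (infty_pt E).
      have cp : ext_closure D (g (infty_pt E')) by apply: gcl; exists (infty_pt E').
      move: cp (fg _ inf_D'); case: (g (infty_pt E')) => [x|//].
      move=> /ext_closure_fin/closure_boundary[Dx|Bx].
        by rewrite -/(fin_pt x) fD.
      by rewrite -/(fin_pt x) (fB x Bx).1.
    have [_ Gb Fb] := gB b Bb.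
    have [a Ba ab] := unbounded_boundary (G b) (L * boundary_dist D' y) oD iso inf_D.
    exists (F a); first by have [] := fB a Ba.
    have /andP[l1 _] := lipF _ _ Ba Gb; rewrite Fb in l1; apply: le_trans l1.
    by rewrite ler_pdivlMr// mulrC.
  have contF b e : finite_boundary D b -> 0 < e -> exists2 eta, 0 < eta &
      forall z, D z -> `|z - b| < eta -> `|F z - F b| < e.
    move=> Bb e0; have [eta eta0 H] := finite_continuity cf (ext_closure_boundary Bb) (fB b Bb).1 e0.
    by exists eta => // z Dz zb; apply: (H z) => //; [exact: ext_closure_sub|exact: fD].
  have contG b e : finite_boundary D' b -> 0 < e -> exists2 eta, 0 < eta &
      forall z, D' z -> `|z - b| < eta -> `|G z - G b| < e.
    move=> Bb e0; have [gb _ _] := gB b Bb.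
    have [eta eta0 H] := finite_continuity cg (ext_closure_boundary Bb) gb e0.
    by exists eta => // z Dz zb; apply: (H z) => //; [exact: ext_closure_sub|rewrite gD// GD].
  have relF x y : D x -> D y ->
      relative_distance D' (F x) (F y) <= relative_distance D x y ^+ m.
    move=> Dx Dy; rewrite !FD//.
    apply: (relative_distance_control C1 M0 Cn Mm hD hD' uD uD' Dx Dy (f0D' _ Dx) (f0D' _ Dy));
      exact: k1.
  have relG x y : D' x -> D' y ->
      relative_distance D (G x) (G y) <= relative_distance D' x y ^+ m.
    move=> Dx Dy; rewrite !GD//.
    apply: (relative_distance_control C1 M0 Cn Mm hD' hD uD' uD Dx Dy (g1D _ Dx) (g1D _ Dy));
      exact: k2.
  have ctlF : controlled C L r1 m D D' F.
    split=> //.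
    - by move=> x Dx; rewrite FD//; exact: f0D'.
    - by move=> b /fB[].
    - by move=> a b Ba Bb; have /andP[] := lipF a b Ba Bb.
    - move=> x y Dx Dy; rewrite -{1}(GF x Dx) -{1}(GF y Dy); apply: relG.
        by rewrite FD//; exact: f0D'.
      by rewrite FD//; exact: f0D'.
    - exact: uniform_corkscrew.
  have ctlG : controlled C L rho m D' D G.
    split=> //.
    - by move=> x Dx; rewrite GD//; exact: g1D.
    - by move=> b /gB[].
    - move=> x y Dx Dy; rewrite -{1}(FG x Dx) -{1}(FG y Dy); apply: relF.
        by rewrite GD//; exact: g1D.
      by rewrite GD//; exact: g1D.
    - exact: uniform_corkscrew.
  have appF x e : closure D x -> 0 < e ->
      exists z, [/\ D z, `|z - x| < e & `|F z - F x| < e].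
    move=> cx e0; have [Dx|Bx] := closure_boundary cx.
      by exists x; rewrite !subrr !normr0.
    have [eta eta0 H] := contF x e Bx e0.
    have me : 0 < Num.min e eta by rewrite lt_min e0.
    have [z Dz] := (closure_dist D x).1 cx _ me; rewrite distrC lt_min => /andP[z1 z2].
    by exists z; split => //; exact: H.
  have upF x y : closure D x -> closure D y -> `|F x - F y| <= Lam1 * `|x - y|.
    apply: (@lipschitz_closure _ _ _ _ _ _ F id); first lra.
      by move=> u e cu /(appF u e cu)[z [Dz zu Fz]]; exists z.
    by move=> u v Du Dv; apply: lip1 ctlF Du Dv.
  have FDD x : D x -> D' (F x) by move=> Dx; rewrite FD//; exact: f0D'.
  have lowF x y : closure D x -> closure D y -> `|x - y| <= Lam2 * `|F x - F y|.
    apply: (@lipschitz_closure _ _ _ _ _ _ id F); first lra.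
      by move=> u e cu /(appF u e cu).
    move=> u v Du Dv; rewrite -{1}(GF u Du) -{1}(GF v Dv).
    by apply: lip2 ctlG _ _; exact: FDD.
  have finF x : closure D x -> f (fin_pt x) = fin_pt (F x).
    by move=> /closure_boundary[/fD|/fB[]].
  move=> x y /ext_closure_fin cx /ext_closure_fin cy.
  exists (F x), (F y); split; try exact: finF.
    rewrite ler_pdivrMr; last lra.
    have := lowF x y cx cy; have : 0 <= Lam1 * `|F x - F y| by rewrite mulr_ge0//; lra.
    lra.
  have := upF x y cx cy; have : 0 <= Lam2 * `|x - y| by rewrite mulr_ge0//; lra.
  lra.
Qed.
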